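(* Let $Y=Y_1\times Y_2$ be a product of compact connected complex manifolds and let $f: Y\longrightarrow X$ be a holomorphic map into a compact Riemann surface $X$ of genus $\geq 2$. Then, denoting each $y\in Y$ as $(y_1,y_2)$ with $y_j\in Y_j$, $j=1,2$, the map $f$ depends on at most one of $y_1$ and $y_2$; i.e., either $f(y_1,y_2)$ is independent of $y_1$ or $f(y_1,y_2)$ is independent of $y_2$.
   Context: A Riemann surface is a connected complex manifold of complex dimension one. *)

(* Defs.v *)
From HB Require Import structures.
From mathcomp Require Import all_boot all_order all_algebra.
From mathcomp Require Import all_classical all_reals all_analysis.
From mathcomp Require Import complex.

Set Implicit Arguments.
Unset Strict Implicit.
Unset Printing Implicit Defensive.
Import Order.TTheory GRing.Theory Num.Theory.
Import numFieldNormedType.Exports.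
Local Open Scope classical_set_scope.
Local Open Scope ring_scope.

(* The field R[i] packaged as a [numFieldType]: the topology and the norm of
   MathComp-Analysis are attached to [numFieldType]s, not to the bare type. *)
Definition CC (R : realType) : numFieldType := R[i].

(* C^n is the space 'rV[CC R]_n of row vectors, and "holomorphic" is Frechet
   differentiability over CC R at every point of an open set. *)

(* A homeomorphism from the open set [chart_dom] of T onto an open subset of
   C^n.  [chart_map] and [chart_inv] are total functions that are meaningful
   only on [chart_dom] and on its image. *)
Record chart (R : realType) (n : nat) (T : topologicalType) := Chart {
  chart_dom : set T;
  chart_map :> T -> 'rV[CC R]_n;
  chart_inv : 'rV[CC R]_n -> T;
  chart_dom_open : open chart_dom;
  chart_codom_open : open (chart_map @` chart_dom);
  chart_mapK : forall x, chart_dom x -> chart_inv (chart_map x) = x;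
  chart_map_continuous :
    forall x, chart_dom x -> {for x, continuous chart_map};
  chart_inv_continuous :
    forall x, chart_dom x -> {for chart_map x, continuous chart_inv} }.

Definition transition (R : realType) (n : nat) (T : topologicalType)
    (phi psi : chart R n T) : 'rV[CC R]_n -> 'rV[CC R]_n :=
  psi \o chart_inv phi.

(* The atlas need not be maximal. *)
Record complexManifold (R : realType) (n : nat) := ComplexManifold {
  carrier :> topologicalType;
  manifold_hausdorff : hausdorff_space carrier;
  manifold_second_countable : @second_countable carrier;
  atlas : set (chart R n carrier);
  atlas_cover : forall x, exists2 phi, atlas phi & chart_dom phi x;
  atlas_holomorphic : forall phi psi, atlas phi -> atlas psi ->
    forall x, chart_dom phi x -> chart_dom psi x ->
    differentiable (transition phi psi) (phi x) }.

Definition holomorphic (R : realType) (m n : nat)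
    (M : complexManifold R m) (N : complexManifold R n) (f : M -> N) : Prop :=
  continuous f /\
  forall (phi : chart R m M) (psi : chart R n N), atlas phi -> atlas psi ->
  forall x, chart_dom phi x -> chart_dom psi (f x) ->
  differentiable (psi \o f \o chart_inv phi) (phi x).

(* In the coordinates z of the chart phi, the form is
   \sum_k (form_coef phi x) k 0 dz_k at the point x; so its value on a tangent
   vector with row of coordinates v is v *m form_coef phi x, and the change of
   chart is given by the Jacobian matrix, which acts on rows.  The coefficients
   are meaningful only for charts of the atlas and points of their domain. *)
Record holomorphicForm (R : realType) (n : nat) (M : complexManifold R n) :=
  HolomorphicForm {
  form_coef :> chart R n M -> M -> 'cV[CC R]_n;
  form_holomorphic : forall phi, atlas phi -> forall x, chart_dom phi x ->
    differentiable (form_coef phi \o chart_inv phi) (phi x);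
  form_compatible : forall phi psi, atlas phi -> atlas psi ->
    forall x, chart_dom phi x -> chart_dom psi x ->
    form_coef phi x = 'J (transition phi psi) (phi x) *m form_coef psi x }.

Definition is_lincomb_form (R : realType) (n : nat) (M : complexManifold R n)
    (g : nat) (w : 'I_g -> holomorphicForm M) (c : 'I_g -> CC R)
    (e : chart R n M -> M -> 'cV[CC R]_n) : Prop :=
  forall phi, atlas phi -> forall x, chart_dom phi x ->
  e phi x = \sum_(k < g) c k *: w k phi x.

(* The genus of a compact Riemann surface X is the dimension of the complex
   vector space of holomorphic 1-forms on X. *)
Definition has_genus (R : realType) (X : complexManifold R 1) (g : nat) : Prop :=
  exists w : 'I_g -> holomorphicForm X,
    (forall c : 'I_g -> CC R,
       is_lincomb_form w c (fun _ _ => 0) -> forall k, c k = 0) /\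
    (forall e : holomorphicForm X,
       exists c : 'I_g -> CC R, is_lincomb_form w c e).

Section RowMx.
Context (K : numFieldType) (m n : nat).

Let row_mxl (u : 'rV[K]_m) : 'rV[K]_(m + n) := row_mx u 0.
Let row_mxr (u : 'rV[K]_n) : 'rV[K]_(m + n) := row_mx 0 u.

Lemma continuous_row_mx (T : topologicalType) (f : T -> 'rV[K]_m)
    (g : T -> 'rV[K]_n) x : {for x, continuous f} -> {for x, continuous g} ->
  {for x, continuous (fun y => row_mx (f y) (g y) : 'rV[K]_(m + n))}.
Proof.
move=> cf cg A /nbhs_ballP[e /= e0 eA].
have Hf : \forall y \near x, ball (f x) e (f y) := cf _ (nbhsx_ballx (f x) e e0).
have Hg : \forall y \near x, ball (g x) e (g y) := cg _ (nbhsx_ballx (g x) e e0).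
rewrite /= nbhs_simpl /=; near=> y.
have [_ fy] : ball (f x) e (f y) by near: y.
have [_ gy] : ball (g x) e (g y) by near: y.
apply: eA; split => // i j; rewrite !mxE.
by case: (fintype.split j) => k; [exact: fy|exact: gy].
Unshelve. all: by end_near. Qed.

Lemma differentiable_row_mx (V : normedModType K) (f : V -> 'rV[K]_m)
    (g : V -> 'rV[K]_n) x : differentiable f x -> differentiable g x ->
  differentiable (fun y => row_mx (f y) (g y) : 'rV[K]_(m + n)) x.
Proof.
move=> df dg.
have ll : linear row_mxl.
  by move=> a u v; rewrite /row_mxl scale_row_mx add_row_mx scaler0 addr0.
have lr : linear row_mxr.
  by move=> a u v; rewrite /row_mxr scale_row_mx add_row_mx scaler0 addr0.
pose L : {linear _ -> _} := HB.pack row_mxl (GRing.isLinear.Build _ _ _ _ row_mxl ll).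
pose M : {linear _ -> _} := HB.pack row_mxr (GRing.isLinear.Build _ _ _ _ row_mxr lr).
have cl : continuous row_mxl.
  by move=> u; apply: (@continuous_row_mx _ id (fun=> 0)); [exact: cvg_id|exact: cst_continuous].
have cr : continuous row_mxr.
  by move=> u; apply: (@continuous_row_mx _ (fun=> 0) id); [exact: cst_continuous|exact: cvg_id].
have -> : (fun y => row_mx (f y) (g y)) = (row_mxl \o f) + (row_mxr \o g).
  by apply/funext => y /=; rewrite !fctE /row_mxl /row_mxr add_row_mx addr0 add0r.
by apply: differentiableD; apply: differentiable_comp => //;
  [exact: (@linear_differentiable _ _ _ L)|exact: (@linear_differentiable _ _ _ M)].
Qed.
End RowMx.

Section ProductTopology.
Context (S T : topologicalType).

Lemma open_setX (A : set S) (B : set T) :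
  open A -> open B -> open (A `*` B : set (S * T)%type).
Proof.
move=> oA oB; rewrite openE => -[x y] [/= Ax By].
by exists (A, B) => //; split; exact: open_nbhs_nbhs.
Qed.

Lemma hausdorff_prod :
  hausdorff_space S -> hausdorff_space T -> hausdorff_space (S * T)%type.
Proof.
move=> hS hT [x1 x2] [y1 y2] xy; congr pair.
- apply: hS => A B xA yB.
  have [] := xy (A `*` setT) (B `*` setT).
  + by exists (A, setT) => //; split => //; exact: filterT.
  + by exists (B, setT) => //; split => //; exact: filterT.
  + by move=> [u v] [[/= Au _] [Bu _]]; exists u.
- apply: hT => A B xA yB.
  have [] := xy (setT `*` A) (setT `*` B).
  + by exists (setT, A) => //; split => //; exact: filterT.
  + by exists (setT, B) => //; split => //; exact: filterT.
  + by move=> [u v] [[/= _ Av] [_ Bv]]; exists v.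
Qed.

Lemma second_countable_prod : @second_countable S -> @second_countable T ->
  @second_countable (S * T)%type.
Proof.
move=> [A cA [oA bA]] [B cB [oB bB]].
exists [set U.1 `*` U.2 | U in A `*` B].
  by apply: sub_countable (card_image_le _ _) _; exact: countableX.
split=> [_ [[U V] [/= AU BV] <-]|[x y] W [[P Q] [/= xP yQ] PQW]].
  by apply: open_setX; [exact: oA|exact: oB].
have [U [AU Ux] UP] := bA x _ xP.
have [V [BV Vy] VQ] := bB y _ yQ.
exists (U `*` V); first by split => //; exists (U, V).
by move=> [u v] [/= /UP Pu /VQ Qv]; exact: PQW.
Qed.

End ProductTopology.

Section ProductManifold.
Context (R : realType) (m n : nat).

Section ProductChart.
Context (S T : topologicalType) (phi : chart R m S) (psi : chart R n T).

Let dom : set (S * T)%type := chart_dom phi `*` chart_dom psi.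
Let map (p : S * T) : 'rV[CC R]_(m + n) := row_mx (phi p.1) (psi p.2).
Let inv (v : 'rV[CC R]_(m + n)) : S * T :=
  (chart_inv phi (lsubmx v), chart_inv psi (rsubmx v)).

Fact prod_chart_dom_open : open dom.
Proof. by apply: open_setX; exact: chart_dom_open. Qed.

Fact prod_chart_codom_open : open (map @` dom).
Proof.
have -> : map @` dom =
    (@lsubmx (CC R) 1 m n @^-1` (phi @` chart_dom phi)) `&`
    (@rsubmx (CC R) 1 m n @^-1` (psi @` chart_dom psi)).
  apply/seteqP; split=> [_ [[x y] [/= xd yd] <-]|v [[x xd xv] [y yd yv]]].
    by split => /=; rewrite ?row_mxKl ?row_mxKr; [exists x|exists y].
  by exists (x, y) => //; rewrite /map /= xv yv hsubmxK.
apply: openI.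
  apply: open_comp => [u _|]; [exact: continuous_lsubmx|exact: chart_codom_open].
apply: open_comp => [u _|]; [exact: continuous_rsubmx|exact: chart_codom_open].
Qed.

Fact prod_chart_mapK p : dom p -> inv (map p) = p.
Proof.
case: p => x y [/= xd yd]; rewrite /inv /map /= row_mxKl row_mxKr.
by rewrite !chart_mapK.
Qed.

Fact prod_chart_map_continuous p : dom p -> {for p, continuous map}.
Proof.
case: p => x y [/= xd yd]; apply: continuous_row_mx.
  apply: (@cvg_comp _ _ _ fst phi _ (nbhs x)); first exact: cvg_fst.
  exact: chart_map_continuous.
apply: (@cvg_comp _ _ _ snd psi _ (nbhs y)); first exact: cvg_snd.
exact: chart_map_continuous.
Qed.

Fact prod_chart_inv_continuous p : dom p -> {for map p, continuous inv}.
Proof.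
case: p => x y [/= xd yd].
have cl : {for map (x, y), continuous (chart_inv phi \o lsubmx)}.
  apply: continuous_comp; first exact: continuous_lsubmx.
  by rewrite /map /= row_mxKl; exact: chart_inv_continuous.
have cr : {for map (x, y), continuous (chart_inv psi \o rsubmx)}.
  apply: continuous_comp; first exact: continuous_rsubmx.
  by rewrite /map /= row_mxKr; exact: chart_inv_continuous.
exact: cvg_pair cl cr.
Qed.

Definition prod_chart : chart R (m + n) (S * T)%type :=
  @Chart R (m + n) (S * T)%type dom map inv
    prod_chart_dom_open prod_chart_codom_open prod_chart_mapK
    prod_chart_map_continuous prod_chart_inv_continuous.

End ProductChart.

Context (M : complexManifold R m) (N : complexManifold R n).

Let prod_atlas : set (chart R (m + n) (M * N)%type) :=
  [set prod_chart phi psi | phi in @atlas R m M & psi in @atlas R n N].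

Fact prod_atlas_cover p : exists2 phi, prod_atlas phi & chart_dom phi p.
Proof.
case: p => x y.
have [phi aphi xphi] := atlas_cover x; have [psi apsi ypsi] := atlas_cover y.
by exists (prod_chart phi psi) => //; exists phi => //; exists psi.
Qed.

Fact prod_atlas_holomorphic phi psi : prod_atlas phi -> prod_atlas psi ->
  forall p, chart_dom phi p -> chart_dom psi p ->
  differentiable (transition phi psi) (phi p).
Proof.
move=> [f1 af1 [f2 af2 <-]] [g1 ag1 [g2 ag2 <-]] [x y] [/= xf yf] [/= xg yg].
apply: differentiable_row_mx.
  apply: (@differentiable_comp _ _ _ _ lsubmx (transition f1 g1)).
    exact: differentiable_lsubmx.
  by rewrite row_mxKl; exact: atlas_holomorphic.
apply: (@differentiable_comp _ _ _ _ rsubmx (transition f2 g2)).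
  exact: differentiable_rsubmx.
by rewrite row_mxKr; exact: atlas_holomorphic.
Qed.

Definition prod_manifold : complexManifold R (m + n) :=
  @ComplexManifold R (m + n) (M * N)%type
    (hausdorff_prod (@manifold_hausdorff _ _ M) (@manifold_hausdorff _ _ N))
    (second_countable_prod (@manifold_second_countable _ _ M)
       (@manifold_second_countable _ _ N))
    prod_atlas prod_atlas_cover prod_atlas_holomorphic.

End ProductManifold.

(* Main.v *)
(** For a holomorphic 1-form [w] on [X], a point [a] of [Y1] and a tangent vector
    [v] at [a], the function [y |-> w (d/ds f (a + s v, y))] is holomorphic on the
    compact connected [Y2], hence constant.  Take two independent forms [w0], [w1].
    If these constants vanish for [w0] and all [(a, v)], then [f] does not depend
    on [y1], because the zeros of [w0] are isolated.  Otherwise let [al <> 0] and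
    [be] be the constants of [w0] and [w1] for some [(a, v)]: the nonzero form
    [al w1 - be w0] vanishes along [f (a, _)], so [f (a, _)] is constant.  Hence the
    constants of [w0] in the [Y2] directions vanish at [y1 = a]; as they do not
    depend on [y1], [f] does not depend on [y2].

    The one-variable function theory behind this is derived from the mean value
    property on circles, which is Goursat's theorem for [z |-> f (a + exp z)] on a
    rectangle of height [2 pi]. *)

Require Import Defs.
From mathcomp Require Import all_boot all_order all_algebra.
From mathcomp Require Import all_classical all_reals all_analysis.
From mathcomp Require Import complex ring lra.

Set Implicit Arguments.
Unset Strict Implicit.
Unset Printing Implicit Defensive.
Import Order.TTheory GRing.Theory Num.Theory.
Import numFieldNormedType.Exports.
Local Open Scope classical_set_scope.
Local Open Scope ring_scope.

(** Holomorphy is differentiability at each point, with no continuity of the derivative, so the mean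
    value property cannot be had by differentiating under the integral: hence Goursat. The same
    obstacle meets [y |-> w (d/ds f (a + s v, y))], which involves a partial derivative of f. It is
    reached as a locally uniform limit of difference quotients in s and is never shown to be
    differentiable: it inherits continuity and, on chart lines, the mean value property, which
    suffice for the maximum argument. The limit is uniform in y because f is jointly continuous and
    the second-order Taylor remainder is bounded by the sup norm alone. The mean value property is
    proved for functions that are merely continuous at the centre. This admits difference quotients
    completed by the derivative; they yield the Cauchy estimates, and also the division by zeros
    that replaces power series in the proof that zeros are isolated. Several variables enter only
    through complex lines in charts: each y near y0 is the value at -1 of a line through y0, and -1
    lies on the unit circle. *)

(** * Integrals of continuous real functions on segments *)

Section IntervalIntegral.
Context (R : realType).
Implicit Types (a b c : R) (f g : R -> R).

Definition rint a b f : R :=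
  \int[@lebesgue_measure R]_(x in [set` `[a, b]]) f x.

Lemma continuous_integrable_itv a b f : {in `[a, b], continuous f} ->
  (@lebesgue_measure R).-integrable [set` `[a, b]] (EFin \o f).
Proof.
move=> cf; apply: continuous_compact_integrable; first exact: segment_compact.
by apply: continuous_in_subspaceT => x; rewrite inE => /cf.
Qed.

Lemma eq_rint a b f g : {in `[a, b], f =1 g} -> rint a b f = rint a b g.
Proof. by move=> fg; apply: eq_Rintegral => x; rewrite inE => /fg. Qed.

Lemma rint_cst a b (k : R) : a <= b -> rint a b (fun=> k) = k * (b - a).
Proof.
move=> ab; rewrite /rint Rintegral_cst//= lebesgue_measure_itv/= lte_fin.
by case: ltrP => //= ba; have -> : a = b by [apply/eqP; rewrite eq_le ab]; rewrite subrr.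
Qed.

Lemma rintB a b f g : {in `[a, b], continuous f} -> {in `[a, b], continuous g} ->
  rint a b (fun x => f x - g x) = rint a b f - rint a b g.
Proof. by move=> cf cg; apply: RintegralB => //; exact: continuous_integrable_itv. Qed.

Lemma ler_rint a b f g : {in `[a, b], continuous f} ->
  {in `[a, b], continuous g} -> {in `[a, b], forall x, f x <= g x} ->
  rint a b f <= rint a b g.
Proof.
move=> cf cg fg; apply: le_Rintegral => //; exact: continuous_integrable_itv.
Qed.

Lemma rint_split a b c f : a <= c -> c <= b -> {in `[a, b], continuous f} ->
  rint a b f = rint a c f + rint c b f.
Proof.
move=> ac cb cf; have := @Rintegral_itvB R f (BLeft a) (BRight b) c.
move=> /(_ (continuous_integrable_itv cf)); rewrite !bnd_simp => /(_ ac cb).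
rewrite Rintegral_itv_obnd_cbnd => [e|]; first by rewrite /rint -[X in _ + X]e addrC subrK.
apply: integrableS (continuous_integrable_itv cf) => //.
by apply: subset_itvr; rewrite bnd_simp.
Qed.

(** The common shape of the integral estimates below: a uniform error on the integrand costs at most
    its product with the length. *)
Lemma rint_near a b f (k e : R) : a <= b -> {in `[a, b], continuous f} ->
  {in `[a, b], forall x, `|f x - k| <= e} ->
  `|rint a b f - k * (b - a)| <= e * (b - a).
Proof.
move=> ab cf fk.
have ck (l : R) : {in `[a, b], continuous (fun=> l)} by move=> x _; exact: cvg_cst.
have h1 : rint a b f <= (k + e) * (b - a).
  rewrite -rint_cst//; apply: ler_rint => // x /fk; rewrite ler_norml; lra.
have h2 : (k - e) * (b - a) <= rint a b f.
  rewrite -rint_cst//; apply: ler_rint => // x /fk; rewrite ler_norml; lra.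
rewrite ler_norml; apply/andP; split; lra.
Qed.

(** Equality case of the mean inequality: if [f x < k], then [f] stays below [k - e] on a short
    interval around [x], and the integral loses [e] times its length. *)
Lemma rint_ge_eq a b f (k : R) : {in `[a, b], continuous f} ->
  {in `[a, b], forall x, f x <= k} -> k * (b - a) <= rint a b f ->
  {in `]a, b[, forall x, f x = k}.
Proof.
move=> cf fk kf x xab; apply/eqP; rewrite eq_le.
have sub : {subset `]a, b[ <= `[a, b]} by apply: subset_itv_oo_cc.
rewrite fk ?sub//= leNgt; apply/negP => fxk.
have cfx : {for x, continuous f} by apply: cf; exact: sub.
pose e := (k - f x) / 2.
have e0 : 0 < e by rewrite /e; lra.
have /cvgrPdist_le/(_ _ e0) := cfx.
move/nbhs_ballP => [d /= d0 fd].
move: (xab); rewrite in_itv/= => /andP[ax xb].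
(* Half of [d] keeps the closed interval from [l] to [r] inside the open ball of radius [d];
   clipping keeps it inside [[a, b]]. *)
pose l := Num.max a (x - d / 2); pose r := Num.min b (x + d / 2).
have l1 : a <= l by rewrite le_max lexx.
have l2 : l < x by rewrite gt_max ax/=; lra.
have r1 : r <= b by rewrite ge_min lexx.
have r2 : x < r by rewrite lt_min xb/=; lra.
have l3 : x - d / 2 <= l by rewrite le_max lexx orbT.
have r3 : r <= x + d / 2 by rewrite ge_min lexx orbT.
have subi (u v : R) : a <= u -> v <= b -> {subset `[u, v] <= `[a, b]}.
  by move=> au vb; apply: subset_itv; rewrite bnd_simp.
have cfi (u v : R) : a <= u -> v <= b -> {in `[u, v], continuous f}.
  by move=> au vb y /(subi _ _ au vb)/cf.
have ck (m : R) (u v : R) : {in `[u, v], continuous (fun=> m)}.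
  by move=> y _; exact: cvg_cst.
have bd (u v : R) : a <= u -> u <= v -> v <= b -> rint u v f <= k * (v - u).
  move=> au uv vb; rewrite -rint_cst//; apply: ler_rint => //; first exact: cfi.
  by move=> y /(subi _ _ au vb)/fk.
have mid : rint l r f <= (k - e) * (r - l).
  rewrite -rint_cst; last lra.
  apply: ler_rint => //; first exact: cfi.
  move=> y; rewrite in_itv/= => /andP[ly yr].
  have : `|f x - f y| <= e.
    by apply: fd; rewrite /ball/= ltr_norml; apply/andP; split; lra.
  by rewrite ler_norml /e; lra.
have := bd _ _ (lexx a) l1 (le_trans (ltW l2) (ltW xb)).
have := bd _ _ (le_trans (ltW ax) (ltW r2)) r1 (lexx b).
have e1 : rint a b f = rint a l f + rint l b f by apply: rint_split => //; lra.
have e2 : rint l b f = rint l r f + rint r b f.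
  by apply: rint_split => //; [lra|exact: cfi].
have : 0 < e * (r - l) by apply: mulr_gt0 => //; lra.
nra.
Qed.

End IntervalIntegral.

(** * Goursat's theorem on rectangles, in real form *)

Section Goursat.
Context (R : realType).
Implicit Types (U V : R -> R -> R).

(** Outward flux of the field (U, V) through the boundary of the rectangle. For U = re G and V = -
    im G it is the imaginary part of the contour integral of G. *)
Definition flux U V (a b c d : R) : R :=
  (rint c d (U b) - rint c d (U a)) +
  (rint a b (V ^~ d) - rint a b (V ^~ c)).

(* (U, V) is differentiable at (x0, y0) with dU/dx + dV/dy = 0. *)
Definition divergence_free U V (x0 y0 : R) := exists p q r : R,
  forall e, 0 < e -> exists2 d, 0 < d & forall x y,
  `|x - x0| <= d -> `|y - y0| <= d ->
  `|U x y - (U x0 y0 + p * (x - x0) + q * (y - y0))| <=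
    e * (`|x - x0| + `|y - y0|) /\
  `|V x y - (V x0 y0 + r * (x - x0) - p * (y - y0))| <=
    e * (`|x - x0| + `|y - y0|).

Lemma lipschitz_at_continuous (f : R -> R) (x0 d k : R) : 0 < d -> 0 <= k ->
  (forall x, `|x - x0| <= d -> `|f x - f x0| <= k * `|x - x0|) ->
  {for x0, continuous f}.
Proof.
move=> d0 k0 fk; apply/cvgrPdist_le => e e0.
near=> x.
have xd : `|x - x0| <= d.
  rewrite distrC; near: x; exact: (@cvgr_dist_le _ _ _ _ _ id x0).
rewrite distrC (le_trans (fk _ xd))//.
have : `|x - x0| <= e / (k + 1).
  rewrite distrC; near: x; apply: (@cvgr_dist_le _ _ _ _ _ id x0) => //.
  by rewrite divr_gt0//; lra.
rewrite ler_pdivlMr; last lra.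
have := normr_ge0 (x - x0); nra.
Unshelve. all: by end_near. Qed.

(** The flux integrates U along vertical edges and V along horizontal ones, so each is considered in
    that one variable. *)
Lemma divergence_free_continuous U V x0 y0 : divergence_free U V x0 y0 ->
  {for y0, continuous (U x0)} /\ {for x0, continuous (V ^~ y0)}.
Proof.
move=> [p [q [r H]]]; have [d d0 {}H] := H 1 ltr01.
split.
  apply: (@lipschitz_at_continuous _ _ d (1 + `|q|)) => // y yd.
  have [|h _] := H x0 y _ yd; first by rewrite subrr normr0 ltW.
  rewrite subrr mulr0 addr0 normr0 add0r mul1r in h.
  have e : U x0 y - U x0 y0 = (U x0 y - (U x0 y0 + q * (y - y0))) + q * (y - y0) by ring.
  by rewrite {}e (le_trans (ler_normD _ _))// normrM mulrDl mul1r lerD.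
apply: (@lipschitz_at_continuous _ _ d (1 + `|r|)) => // x xd.
have [|_ h] := H x y0 xd; first by rewrite subrr normr0 ltW.
rewrite subrr mulr0 subr0 normr0 addr0 mul1r in h.
have e : V x y0 - V x0 y0 = (V x y0 - (V x0 y0 + r * (x - x0))) + r * (x - x0) by ring.
by rewrite {}e (le_trans (ler_normD _ _))// normrM mulrDl mul1r lerD.
Qed.

Let div_free_on U V (a b c d : R) := forall x y,
  a <= x <= b -> c <= y <= d -> divergence_free U V x y.

Let contU U V a b c d x : div_free_on U V a b c d -> a <= x <= b ->
  {in `[c, d], continuous (U x)}.
Proof.
by move=> H xab y; rewrite in_itv/= => yc; have [] := divergence_free_continuous (H _ _ xab yc).
Qed.

Let contV U V a b c d y : div_free_on U V a b c d -> c <= y <= d ->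
  {in `[a, b], continuous (V ^~ y)}.
Proof.
by move=> H ycd x; rewrite in_itv/= => xab; have [] := divergence_free_continuous (H _ _ xab ycd).
Qed.

Lemma flux_split1 U V a b c d e : a <= e -> e <= b -> c <= d ->
  div_free_on U V a b c d -> flux U V a b c d = flux U V a e c d + flux U V e b c d.
Proof.
move=> ae eb cd H; rewrite /flux.
rewrite (@rint_split _ a b e (V ^~ d))//; last by apply: contV H _; rewrite cd lexx.
rewrite (@rint_split _ a b e (V ^~ c))//; last by apply: contV H _; rewrite cd lexx.
ring.
Qed.

Lemma flux_split2 U V a b c d e : c <= e -> e <= d -> a <= b ->
  div_free_on U V a b c d -> flux U V a b c d = flux U V a b c e + flux U V a b e d.
Proof.
move=> ce ed ab H; rewrite /flux.
rewrite (@rint_split _ c d e (U b))//; last by apply: contU H _; rewrite ab lexx.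
rewrite (@rint_split _ c d e (U a))//; last by apply: contU H _; rewrite ab lexx.
ring.
Qed.

(** The affine part of the field at (x0, y0) has zero flux: opposite edges cancel the other terms,
    and the two contributions of [p] cancel each other. Only the remainder counts, at most [e / 2]
    times the half perimeter on each edge. *)
Lemma flux_small U V (x0 y0 : R) : divergence_free U V x0 y0 ->
  forall e, 0 < e -> exists2 t, 0 < t & forall a b c d,
  a <= x0 <= b -> c <= y0 <= d -> b - a <= t -> d - c <= t ->
  div_free_on U V a b c d ->
  `|flux U V a b c d| <= e * (b - a + (d - c)) ^+ 2.
Proof.
move=> [p [q [r H]]] e e0; have [|t t0 {}H] := H (e / 2); first by rewrite divr_gt0.
exists t => // a b c d /andP[ax xb] /andP[cy yd] bat dct D.
have [ab cd] : a <= b /\ c <= d by split; lra.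
have key x y : a <= x <= b -> c <= y <= d ->
    `|U x y - (U x0 y0 + p * (x - x0) + q * (y - y0))| <= e / 2 * (b - a + (d - c)) /\
    `|V x y - (V x0 y0 + r * (x - x0) - p * (y - y0))| <= e / 2 * (b - a + (d - c)).
  move=> /andP[ax' xb'] /andP[cy' yd'].
  have dx : `|x - x0| <= b - a by rewrite ler_norml; apply/andP; split; lra.
  have dy : `|y - y0| <= d - c by rewrite ler_norml; apply/andP; split; lra.
  have [h1 h2] := H x y (le_trans dx bat) (le_trans dy dct).
  have h : e / 2 * (`|x - x0| + `|y - y0|) <= e / 2 * (b - a + (d - c)).
    by apply: ler_wpM2l; [lra|exact: lerD].
  by split; [exact: le_trans h1 h|exact: le_trans h2 h].
have aab : a <= a <= b by rewrite ab lexx.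
have bab : a <= b <= b by rewrite ab lexx.
have ccd : c <= c <= d by rewrite cd lexx.
have dcd : c <= d <= d by rewrite cd lexx.
have HU : `|rint c d (fun y => U b y - U a y) - p * (b - a) * (d - c)| <=
    e * (b - a + (d - c)) * (d - c).
  apply: rint_near => //.
    by move=> y yi; apply: cvgB; [apply: (contU D bab yi)|apply: (contU D aab yi)].
  move=> y; rewrite in_itv/= => yi; have [hb _] := key _ _ bab yi.
  have [ha _] := key _ _ aab yi.
  move: ha hb; rewrite !ler_norml => /andP[? ?] /andP[? ?]; apply/andP; split; lra.
have HV : `|rint a b (fun x => V x d - V x c) - (- (p * (d - c))) * (b - a)| <=
    e * (b - a + (d - c)) * (b - a).
  apply: rint_near => //.
    by move=> y yi; apply: cvgB; [apply: (contV D dcd yi)|apply: (contV D ccd yi)].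
  move=> x; rewrite in_itv/= => xi; have [_ hd] := key _ _ xi dcd.
  have [_ hc] := key _ _ xi ccd.
  move: hd hc; rewrite !ler_norml => /andP[? ?] /andP[? ?]; apply/andP; split; lra.
rewrite rintB in HU; [|exact: contU D bab|exact: contU D aab].
rewrite rintB in HV; [|exact: contV D dcd|exact: contV D ccd].
move: HU HV; rewrite /flux !ler_norml => /andP[? ?] /andP[? ?].
by apply/andP; split; lra.
Qed.

(** Every right end bounds every left end, so the supremum of the left ends lies in all the
    intervals. *)
Lemma nested_halving (a : nat -> R) (l : R) : 0 <= l ->
  (forall n, a n <= a n.+1 /\ a n.+1 + l / 2 ^+ n.+1 <= a n + l / 2 ^+ n) ->
  exists x, forall n, a n <= x <= a n + l / 2 ^+ n.
Proof.
move=> l0 H.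
have pos n : 0 <= l / 2 ^+ n by rewrite divr_ge0// exprn_ge0.
have mono m n : a m <= a (m + n)%N /\ a (m + n)%N + l / 2 ^+ (m + n) <= a m + l / 2 ^+ m.
  elim: n => [|n [h1 h2]]; first by rewrite addn0.
  by have [g1 g2] := H (m + n)%N; rewrite addnS; split; lra.
have up m n : a m <= a n + l / 2 ^+ n.
  have [mn|/ltnW nm] := leqP m n.
    have [] := mono m (n - m)%N; rewrite subnKC// => h _.
    by have := pos n; lra.
  have [] := mono n (m - n)%N; rewrite subnKC// => h1 h2.
  by have := pos m; lra.
exists (sup (range a)) => n; apply/andP; split.
  apply: ub_le_sup; last by exists n.
  by exists (a 0 + l / 2 ^+ 0) => _ [m _ <-].
apply: ge_sup; first by exists (a 0), 0%N.
by move=> _ [m _ <-].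
Qed.

(** The tolerance that closes the bisection argument; [S] is the half perimeter, and [S + 1] keeps
    the divisor positive when the rectangle is a point. *)
Let square_estimate (K S : R) n : 0 < K -> 0 <= S ->
  K / 2 / (S + 1) ^+ 2 * (S / 2 ^+ n) ^+ 2 < K / 4 ^+ n.
Proof.
move=> K0 S0.
have E4 : (2 ^+ n) ^+ 2 = 4 ^+ n :> R.
  by rewrite -exprM mulnC exprM; congr (_ ^+ _); rewrite expr2; ring.
have Q0 : 0 < 4 ^+ n :> R by rewrite exprn_gt0.
have P0 : 0 < (S + 1) ^+ 2 by rewrite exprn_gt0//; lra.
rewrite expr_div_n E4 ltr_pdivlMr//.
have -> : K / 2 / (S + 1) ^+ 2 * (S ^+ 2 / 4 ^+ n) * 4 ^+ n =
    K / 2 * (S ^+ 2 / (S + 1) ^+ 2).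
  by field; rewrite ?gt_eqF//; lra.
have : S ^+ 2 / (S + 1) ^+ 2 <= 1 by rewrite ler_pdivrMr// mul1r; nra.
nra.
Qed.

(** Repeated bisection: one of the four quarters always keeps a quarter of the flux, and the
    quarters shrink to a point where this contradicts [flux_small]. *)
Lemma goursat U V a b c d : a <= b -> c <= d -> div_free_on U V a b c d ->
  flux U V a b c d = 0.
Proof.
move=> ab cd D; apply/eqP; rewrite -normr_le0 leNgt; apply/negP => K0.
set K := `|flux U V a b c d| in K0.
pose l n := (b - a) / 2 ^+ n; pose m n := (d - c) / 2 ^+ n.
have lS n : l n = l n.+1 + l n.+1 by rewrite /l exprS; field; rewrite expf_neq0.
have mS n : m n = m n.+1 + m n.+1 by rewrite /m exprS; field; rewrite expf_neq0.
have l0 n : 0 <= l n by rewrite divr_ge0// ?exprn_ge0//; lra.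
have m0 n : 0 <= m n by rewrite divr_ge0// ?exprn_ge0//; lra.
(* [z] is the lower left corner of a rectangle of the [n]-th generation that still carries its share
   of the flux. *)
pose P n (z : R * R) := [/\ a <= z.1, z.1 + l n <= b, c <= z.2, z.2 + m n <= d &
  K / 4 ^+ n <= `|flux U V z.1 (z.1 + l n) z.2 (z.2 + m n)|].
have step n (z : {z | P n z}) : {z' : {z' | P n.+1 z'} |
    ((sval z).1 <= (sval z').1 /\ (sval z').1 + l n.+1 <= (sval z).1 + l n) /\
    ((sval z).2 <= (sval z').2 /\ (sval z').2 + m n.+1 <= (sval z).2 + m n)}.
  apply: cid; move: z => -[[x y] /= [/= ax xb cy yd KF]].
  have := l0 n.+1; have := m0 n.+1; move: (lS n) (mS n) => lE mE m0' l0'.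
  have sub a' b' c' d' : a <= a' -> b' <= b -> c <= c' -> d' <= d ->
      div_free_on U V a' b' c' d'.
    move=> ? ? ? ? x' y' /andP[? ?] /andP[? ?].
    by apply: D; apply/andP; split; lra.
  have F4 : flux U V x (x + l n) y (y + m n) =
      (flux U V x (x + l n.+1) y (y + m n.+1) +
       flux U V x (x + l n.+1) (y + m n.+1) (y + m n.+1 + m n.+1)) +
      (flux U V (x + l n.+1) (x + l n.+1 + l n.+1) y (y + m n.+1) +
       flux U V (x + l n.+1) (x + l n.+1 + l n.+1) (y + m n.+1) (y + m n.+1 + m n.+1)).
    rewrite (@flux_split1 _ _ _ _ _ _ (x + l n.+1)); [|lra|lra|lra|apply: sub; lra].
    rewrite (@flux_split2 _ _ x _ _ _ (y + m n.+1)); [|lra|lra|lra|apply: sub; lra].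
    rewrite (@flux_split2 _ _ (x + l n.+1) _ _ _ (y + m n.+1)); [|lra|lra|lra|apply: sub; lra].
    by rewrite lE mE !addrA.
  have K4 : K / 4 ^+ n = 4 * (K / 4 ^+ n.+1).
    by rewrite exprS; field; rewrite expf_neq0.
  rewrite F4 K4 in KF.
  have pick x' y' : (x' = x \/ x' = x + l n.+1) -> (y' = y \/ y' = y + m n.+1) ->
      K / 4 ^+ n.+1 <= `|flux U V x' (x' + l n.+1) y' (y' + m n.+1)| ->
      exists z' : {z' | P n.+1 z'}, (x <= (sval z').1 /\ (sval z').1 + l n.+1 <= x + l n) /\
        (y <= (sval z').2 /\ (sval z').2 + m n.+1 <= y + m n).
    move=> hx hy KF'.
    have Pz : P n.+1 (x', y').
      by split => //=; case: hx => hx; case: hy => hy; rewrite ?hx ?hy;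
        clear -ax xb cy yd lE mE m0' l0'; lra.
    by exists (exist _ _ Pz) => /=; case: hx => hx; case: hy => hy;
      split; split; rewrite ?hx ?hy;
        clear -ax xb cy yd lE mE m0' l0'; lra.
  have [h|h1] := lerP (K / 4 ^+ n.+1) `|flux U V x (x + l n.+1) y (y + m n.+1)|.
    by apply: pick h; left.
  have [h|h2] := lerP (K / 4 ^+ n.+1)
      `|flux U V x (x + l n.+1) (y + m n.+1) (y + m n.+1 + m n.+1)|.
    by apply: pick h; [left|right].
  have [h|h3] := lerP (K / 4 ^+ n.+1)
      `|flux U V (x + l n.+1) (x + l n.+1 + l n.+1) y (y + m n.+1)|.
    by apply: pick h; [right|left].
  have [h|h4] := lerP (K / 4 ^+ n.+1) `|flux U V (x + l n.+1)
      (x + l n.+1 + l n.+1) (y + m n.+1) (y + m n.+1 + m n.+1)|.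
    by apply: pick h; right.
  exfalso; move: KF; rewrite leNgt => /negP; apply.
  rewrite (le_lt_trans (ler_normD _ _))//.
  apply: (le_lt_trans (lerD (ler_normD _ _) (ler_normD _ _))); lra.
have P0 : P 0%N (a, c).
  by split => /=; rewrite /l /m ?expr0 ?divr1 ?subrKC//.
pose s := fix s n : {z | P n z} :=
  if n is n'.+1 then sval (step n' (s n')) else exist _ _ P0.
have sS n : s n.+1 = sval (step n (s n)) by [].
have [x0 Hx] := @nested_halving (fun n => (sval (s n)).1) (b - a) ltac:(lra)
  (fun n => proj1 (svalP (step n (s n)))).
have [y0 Hy] := @nested_halving (fun n => (sval (s n)).2) (d - c) ltac:(lra)
  (fun n => proj2 (svalP (step n (s n)))).
have xab : a <= x0 <= b by have := Hx 0%N; rewrite /= expr0 divr1 subrKC.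
have ycd : c <= y0 <= d by have := Hy 0%N; rewrite /= expr0 divr1 subrKC.
pose S := b - a + (d - c).
have e0 : 0 < K / 2 / (S + 1) ^+ 2.
  by rewrite divr_gt0// ?divr_gt0// exprn_gt0// /S; lra.
have [t t0 Ht] := flux_small (D _ _ xab ycd) e0.
(* It is enough to take [n] above [S / t], since [n < 2 ^+ n]. *)
have [n Hn] : exists n, S / 2 ^+ n <= t.
  have [n nS] : exists n : nat, S / t < n%:R.
    by exists (Num.bound (S / t)); apply: archi_boundP; apply: divr_ge0;
      [rewrite /S; lra|exact: ltW].
  exists n; rewrite ler_pdivrMr ?exprn_gt0// mulrC -ler_pdivrMr//.
  apply: (le_trans (ltW nS)).
  by rewrite -natrX ler_nat ltnW// ltn_expl.
have [z1 z2 z3 z4 z5] := svalP (s n).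
have SE : S / 2 ^+ n = l n + m n by rewrite /S /l /m mulrDl.
have := Ht _ _ _ _ (Hx n) (Hy n).
rewrite ![_ + _ / _ - _]addrAC !subrr !add0r -/(l n) -/(m n).
have := l0 n; have := m0 n => mn0 ln0.
have sub : div_free_on U V (sval (s n)).1 ((sval (s n)).1 + l n)
    (sval (s n)).2 ((sval (s n)).2 + m n).
  by move=> x y /andP[? ?] /andP[? ?]; apply: D; apply/andP; split; lra.
move=> /(_ ltac:(lra) ltac:(lra) sub).
move=> /(le_trans z5); rewrite -SE; apply/negP; rewrite -ltNge.
by apply: square_estimate => //; rewrite /S; lra.
Qed.

End Goursat.

(** * Derivatives as first-order expansions *)

Section FirstOrderExpansion.
Context (K : numFieldType).

(** This form has no division and includes [h = 0]; it serves over both the real and the complex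
    field. *)
Lemma is_derive_expansion (f : K -> K) (x D : K) : is_derive x 1 f D <->
  forall e, 0 < e -> \forall h \near 0, `|f (x + h) - f x - D * h| <= e * `|h|.
Proof.
have E h : h != 0 -> `|f (x + h) - f x - D * h| =
    `|D - h^-1 *: (f (h *: 1 + x) - f x)| * `|h|.
  move=> h0; rewrite -normrM distrC; congr `|_|.
  rewrite /GRing.scale/= mulr1 (addrC x) mulrBl mulrAC mulVf// mul1r; ring.
split=> [[/cvg_ex[l fl] ] Dl e e0|H].
  have {}fl : h^-1 *: (f (h *: 1 + x) - f x) @[h --> 0^'] --> D.
    by rewrite -Dl; apply/cvg_ex; exists l.
  have /cvgrPdist_le/(_ e e0) := fl.
  rewrite near_withinE; apply: filterS => h /= H.
  have [->|h0] := eqVneq h 0; first by rewrite addr0 subrr mulr0 subrr normr0 mulr0.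
  by rewrite E// ler_wpM2r// H.
have fl : h^-1 *: ((f \o shift x) (h *: 1) - f x) @[h --> 0^'] --> D.
  apply/cvgrPdist_le => e e0; rewrite near_withinE.
  apply: filterS (H e e0) => h /= {}H h0.
  by move: H; rewrite E// ler_pM2r// normr_gt0.
by split; [apply/cvg_ex; exists D|exact: cvg_lim].
Qed.

End FirstOrderExpansion.

(** * Real-valued modulus and coordinates on the complex plane *)

Section ComplexPlane.
Context (R : realType).
Local Notation C := (CC R).
Implicit Types (z w : C) (f g : C -> C) (r e t : R).

(** The norm of [CC R] takes its values in [CC R] itself; [cmod] is the same number in [R], where
    the order is total. *)
Definition cmod z : R := Normc.normc z.
Definition cpx (x y : R) : C := Complex x y.
Definition creal (x : R) : C := x%:C%C.

Lemma normCmod z : `|z| = creal (cmod z). Proof. by []. Qed.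

Lemma crealM x y : creal (x * y) = creal x * creal y.
Proof. exact: (rmorphM (real_complex R)). Qed.

Lemma crealD x y : creal (x + y) = creal x + creal y.
Proof. exact: (rmorphD (real_complex R)). Qed.

Lemma crealN x : creal (- x) = - creal x.
Proof. exact: (rmorphN (real_complex R)). Qed.

Lemma creal1 : creal 1 = 1. Proof. by []. Qed.

Lemma creal0 : creal 0 = 0. Proof. by []. Qed.

Lemma creal_gt0 x : (0 < creal x) = (0 < x). Proof. exact: ltcR. Qed.
Lemma creal_le x y : (creal x <= creal y) = (x <= y). Proof. exact: lecR. Qed.
Lemma creal_lt x y : (creal x < creal y) = (x < y). Proof. exact: ltcR. Qed.

Lemma gt0_creal z : 0 < z -> exists2 r, 0 < r & z = creal r.
Proof.
move=> z0; exists (cmod z); last by rewrite -normCmod gtr0_norm.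
by rewrite -creal_gt0 -normCmod normr_gt0 gt_eqF.
Qed.

Lemma cmod_ge0 z : 0 <= cmod z.
Proof. by have := normr_ge0 z; rewrite normCmod; rewrite -[X in X <= _]/(creal 0) creal_le. Qed.

Lemma cmodM z w : cmod (z * w) = cmod z * cmod w.
Proof. exact: Normc.normcM. Qed.

Lemma cmodV z : cmod z^-1 = (cmod z)^-1.
Proof. exact: Normc.normcV. Qed.

Lemma cmodD z w : cmod (z + w) <= cmod z + cmod w.
Proof. exact: (@le_normcD R). Qed.

Lemma cmodN z : cmod (- z) = cmod z.
Proof. exact: (@normcN R). Qed.

Lemma cmodB z w : cmod (z - w) <= cmod z + cmod w.
Proof. by rewrite -(cmodN w); exact: cmodD. Qed.

Lemma cmodC z w : cmod (z - w) = cmod (w - z).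
Proof. by rewrite -cmodN opprB. Qed.

Lemma cmod0 : cmod 0 = 0. Proof. exact: Normc.normc0. Qed.

Lemma cmod1 : cmod 1 = 1. Proof. exact: Normc.normc1. Qed.

Lemma cmod_eq0 z : (cmod z == 0) = (z == 0).
Proof. by apply/eqP/eqP => [/Normc.eq0_normc//|->]; exact: cmod0. Qed.

Lemma cmod_gt0 z : (0 < cmod z) = (z != 0).
Proof. by rewrite lt0r cmod_eq0 cmod_ge0 andbT. Qed.

Lemma cmod_creal r : cmod (creal r) = `|r|.
Proof. by rewrite /cmod /creal/= expr0n/= addr0 sqrtr_sqr. Qed.

Lemma cmod_cpx x y : cmod (cpx x y) <= `|x| + `|y|.
Proof.
rewrite /cmod /=; have h : 0 <= `|x| + `|y| by rewrite addr_ge0.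
rewrite -[X in _ <= X]ger0_norm// -sqrtr_sqr ler_wsqrtr//.
rewrite sqrrD !real_normK ?num_real// -addrA lerD2l addrC lerDl.
by rewrite mulrn_wge0// mulr_ge0.
Qed.

Definition re z : R := complex.Re z.
Definition im z : R := complex.Im z.

Lemma cpx_eta z : z = cpx (re z) (im z). Proof. by case: z. Qed.
Lemma reD z w : re (z + w) = re z + re w. Proof. by case: z; case: w. Qed.
Lemma imD z w : im (z + w) = im z + im w. Proof. by case: z; case: w. Qed.
Lemma reN z : re (- z) = - re z. Proof. by case: z. Qed.
Lemma imN z : im (- z) = - im z. Proof. by case: z. Qed.
Lemma reB z w : re (z - w) = re z - re w. Proof. by rewrite reD reN. Qed.
Lemma imB z w : im (z - w) = im z - im w. Proof. by rewrite imD imN. Qed.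
Lemma reM z w : re (z * w) = re z * re w - im z * im w. Proof. by case: z; case: w. Qed.
Lemma imM z w : im (z * w) = re z * im w + im z * re w.
Proof. by case: z => a b; case: w => c d /=; rewrite [b * c]mulrC. Qed.

Lemma cmodE z : cmod z ^+ 2 = re z ^+ 2 + im z ^+ 2.
Proof. by case: z => a b; rewrite /cmod/= sqr_sqrtr// addr_ge0// sqr_ge0. Qed.

Lemma re_le z : `|re z| <= cmod z.
Proof.
by rewrite -(@ler_pXn2r _ 2)// ?nnegrE ?cmod_ge0// real_normK ?num_real// cmodE lerDl sqr_ge0.
Qed.

Lemma im_le z : `|im z| <= cmod z.
Proof.
by rewrite -(@ler_pXn2r _ 2)// ?nnegrE ?cmod_ge0// real_normK ?num_real// cmodE lerDr sqr_ge0.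
Qed.

(** With [u] the conjugate of z divided by its modulus, bounds on a modulus reduce to bounds on the
    real part of a rotated function. *)
Lemma cmod_unit_re z : exists2 u, cmod u = 1 & re (u * z) = cmod z.
Proof.
have [->|z0] := eqVneq z 0; first by exists 1; rewrite ?mulr0 ?cmod1// cmod0.
have m0 : cmod z != 0 by rewrite cmod_eq0.
pose u := cpx (re z / cmod z) (- im z / cmod z).
have uz : re (u * z) = cmod z.
  rewrite reM /u /re /im/= -/(re z) -/(im z).
  have -> : re z / cmod z * re z - - im z / cmod z * im z =
    (re z ^+ 2 + im z ^+ 2) / cmod z by field.
  by rewrite -cmodE expr2 mulfK.
exists u => //; apply/eqP.
rewrite -(@eqrXn2 _ 2)// ?cmod_ge0// cmodE /u /re /im/= -/(re z) -/(im z) expr1n.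
have -> : (re z / cmod z) ^+ 2 + (- im z / cmod z) ^+ 2 =
  (re z ^+ 2 + im z ^+ 2) / cmod z ^+ 2 by field.
by rewrite -cmodE divff// expf_neq0.
Qed.

Lemma near_cmodP (z : C) (P : set C) : (\forall w \near z, P w) <->
  exists2 e, 0 < e & forall w, cmod (w - z) < e -> P w.
Proof.
split=> [/nbhs_ballP[e /= /gt0_creal[r r0 ->] H]|[e e0 H]].
  exists r => // w wz; apply: H.
  by rewrite /ball/= normCmod cmodC creal_lt.
apply/nbhs_ballP; exists (creal e); first by rewrite /= creal_gt0.
by move=> w; rewrite /ball/= normCmod cmodC creal_lt => /H.
Qed.

Lemma continuous_cmodP f z : {for z, continuous f} <->
  forall e, 0 < e -> exists2 d, 0 < d & forall w, cmod (w - z) < d -> cmod (f w - f z) <= e.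
Proof.
split=> [/cvgrPdist_le fz e e0|H].
  have /near_cmodP[d d0 Hd] : \forall w \near z, `|f z - f w| <= creal e.
    by apply: fz; rewrite creal_gt0.
  by exists d => // w /Hd; rewrite normCmod creal_le cmodC.
apply/(@cvgrPdist_le _ _ _ _ (nbhs_filter z)) => _ /gt0_creal[e e0 ->].
have [d d0 Hd] := H e e0; apply/near_cmodP; exists d => // w /Hd.
by rewrite normCmod creal_le cmodC.
Qed.

Lemma is_derive_cmodP f z D : is_derive z 1 f D <->
  forall e, 0 < e -> exists2 d, 0 < d & forall w, cmod (w - z) < d ->
    cmod (f w - f z - D * (w - z)) <= e * cmod (w - z).
Proof.
rewrite is_derive_expansion; split=> H.
  move=> e e0; have /H/near_cmodP[d d0 Hd] : 0 < creal e by rewrite creal_gt0.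
  exists d => // w wz; have := Hd (w - z); rewrite subr0 => /(_ wz).
  by rewrite subrKC !normCmod -crealM creal_le.
move=> _ /gt0_creal[e e0 ->]; have [d d0 Hd] := H e e0.
apply/near_cmodP; exists d => // w; rewrite subr0 => wd.
by have := Hd (z + w); rewrite (addrC z) addrK !normCmod -crealM creal_le; exact.
Qed.

Lemma is_derive_continuous f z D : is_derive z 1 f D -> {for z, continuous f}.
Proof.
by move=> [fz _]; apply: differentiable_continuous; exact/derivable1_diffP.
Qed.

Lemma derivable_continuous f z : derivable f z 1 -> {for z, continuous f}.
Proof. by move=> fz; apply: is_derive_continuous; apply: DeriveDef fz erefl. Qed.

Lemma derivable_comp f g z : derivable g z 1 -> derivable f (g z) 1 ->
  derivable (f \o g) z 1.
Proof.
move=> /(@derivable1_diffP C C) gz /(@derivable1_diffP C C) fz.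
by apply/(@derivable1_diffP C C); exact: (differentiable_comp gz fz).
Qed.

Lemma re_continuous : continuous (re : C -> R).
Proof.
move=> z; apply/(@cvgrPdist_le _ _ _ _ (nbhs_filter z)) => e e0.
apply/near_cmodP; exists e => // w wz.
by rewrite -reB (le_trans (re_le _))// cmodC ltW.
Qed.

End ComplexPlane.

(** * The complex exponential and the mean value over circles *)

Section CircleMean.
Context (R : realType).
Local Notation C := (CC R).
Implicit Types (z w : C) (f g : C -> C) (r e t : R).

Definition expi t : C := cpx (cos t) (sin t).
Definition cexp z : C := creal (expR (re z)) * expi (im z).
Definition circ z r t : C := z + creal r * expi t.

Lemma cmod_expi t : cmod (expi t) = 1.
Proof. by rewrite /cmod/= cos2Dsin2 sqrtr1. Qed.

Lemma cexpD z w : cexp (z + w) = cexp z * cexp w.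
Proof.
rewrite /cexp reD imD expRD /expi cosD sinD crealM -!mulrA; congr (_ * _).
rewrite [RHS]mulrCA; congr (_ * _); rewrite [RHS]cpx_eta reM imM.
by congr cpx; rewrite /re /im/=; ring.
Qed.

Lemma cmod_cexp z : cmod (cexp z) = expR (re z).
Proof. by rewrite cmodM cmod_expi mulr1 cmod_creal gtr0_norm// expR_gt0. Qed.

Lemma cmod_circ z r t : 0 <= r -> cmod (circ z r t - z) = r.
Proof. by move=> r0; rewrite /circ addrC addKr cmodM cmod_expi mulr1 cmod_creal ger0_norm. Qed.

Lemma circ_continuous z r : 0 <= r -> continuous (circ z r).
Proof.
move=> r0 t; apply/cvgrPdist_le => _ /gt0_creal[e e0 ->].
have d0 : 0 < e / (r + 1) / 2 by rewrite !divr_gt0//; lra.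
have /cvgrPdist_le/(_ _ d0) c := @continuous_cos R t.
have /cvgrPdist_le/(_ _ d0) s := @continuous_sin R t.
near=> u; rewrite normCmod creal_le.
have -> : circ z r t - circ z r u = creal r * (expi t - expi u) by rewrite /circ; ring.
rewrite cmodM cmod_creal ger0_norm//.
have -> : expi t - expi u = cpx (cos t - cos u) (sin t - sin u) by [].
have h1 : `|cos t - cos u| <= e / (r + 1) / 2 by near: u; exact: c.
have h2 : `|sin t - sin u| <= e / (r + 1) / 2 by near: u; exact: s.
have h := cmod_cpx (cos t - cos u) (sin t - sin u).
have {h1 h2}h : cmod (cpx (cos t - cos u) (sin t - sin u)) <= e / (r + 1) by lra.
apply: (le_trans (ler_wpM2l r0 h)).
rewrite mulrA ler_pdivrMr; nra.
Unshelve. all: by end_near. Qed.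

Lemma circ_mean_continuous f z r t : 0 <= r -> {for circ z r t, continuous f} ->
  {for t, continuous (fun t => re (f (circ z r t)))}.
Proof.
move=> r0 cf.
apply: (@continuous_comp _ _ _ (f \o circ z r) (@re R)); last exact: re_continuous.
by apply: continuous_comp; [exact: circ_continuous|exact: cf].
Qed.

Lemma cexp_expansion e : 0 < e -> exists2 d, 0 < d & forall h, cmod h < d ->
  cmod (cexp h - 1 - h) <= e * cmod h.
Proof.
move=> e0.
(* The four error terms below are at most [a * m], [3 * a * m], [4 * a * m] and [a * m], together
   less than [16 * a * m]. *)
pose a := Num.min 1 (e / 16); have a0 : 0 < a by rewrite lt_min ltr01/=; lra.
have [a1 ae] : a <= 1 /\ a <= e / 16 by split; rewrite /a ge_min lexx ?orbT.
have Hexp : \forall x \near (0 : R), `|expR (0 + x) - expR 0 - 1 * x| <= a * `|x|.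
  have /is_derive_expansion : is_derive (0 : R) 1 expR 1.
    by rewrite -[X in is_derive _ _ _ X](@expR0 R); exact: is_derive_expR.
  exact.
have Hcos : \forall x \near (0 : R), `|cos (0 + x) - cos 0 - 0 * x| <= a * `|x|.
  have /is_derive_expansion : is_derive (0 : R) 1 cos 0.
    by have := @is_derive_cos R 0; rewrite sin0 oppr0.
  exact.
have Hsin : \forall x \near (0 : R), `|sin (0 + x) - sin 0 - 1 * x| <= a * `|x|.
  have /is_derive_expansion : is_derive (0 : R) 1 sin 1.
    by rewrite -[X in is_derive _ _ _ X](@cos0 R); exact: is_derive_sin.
  exact.
have [d /= d0 Hd] := proj1 (@nbhs_ballP R R 0 _) (filterI Hexp (filterI Hcos Hsin)).
exists (Num.min d a); first by rewrite lt_min d0 a0.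
move=> h; rewrite lt_min => /andP[hd ha].
have inb (x : R) : `|x| <= cmod h -> ball (0 : R) d x.
  by move=> xh; rewrite /ball/= sub0r normrN (le_lt_trans xh).
have [He _] := Hd _ (inb _ (re_le h)).
have [_ [Hc Hs]] := Hd _ (inb _ (im_le h)).
move: He Hc Hs; rewrite !add0r expR0 cos0 sin0 mul0r !mul1r !subr0.
have rx := re_le h; have iy := im_le h; rewrite [h]cpx_eta -cpx_eta.
set x := re h in rx *; set y := im h in iy *; set m := cmod h in rx iy ha hd *.
move=> He Hc Hs.
have -> : cexp h - 1 - h = cpx ((expR x - 1 - x) + expR x * (cos y - 1))
    ((expR x - 1) * sin y + (sin y - y)).
  rewrite [LHS]cpx_eta !reB !imB /cexp reM imM /re /im /= -/(re h) -/(im h) -/x -/y.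
  congr cpx; ring.
apply: (le_trans (cmod_cpx _ _)).
have m0 : 0 <= m := cmod_ge0 h.
have ex1 : `|expR x - 1| <= 2 * a.
  have -> : expR x - 1 = (expR x - 1 - x) + x by ring.
  by have := ler_normD (expR x - 1 - x) x; nra.
have ex2 : `|expR x| <= 3.
  have -> : expR x = (expR x - 1) + 1 by ring.
  by have := ler_normD (expR x - 1) 1; rewrite normr1; lra.
have sy : `|sin y| <= 2 * m.
  have -> : sin y = (sin y - y) + y by ring.
  by have := ler_normD (sin y - y) y; nra.
have k1 := ler_normD (expR x - 1 - x) (expR x * (cos y - 1)).
have k2 := ler_normD ((expR x - 1) * sin y) (sin y - y).
rewrite normrM in k1; rewrite normrM in k2.
have am0 : 0 <= a * m by rewrite mulr_ge0// ltW.
have ax : a * `|x| <= a * m by rewrite ler_wpM2l// ltW.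
have ay : a * `|y| <= a * m by rewrite ler_wpM2l// ltW.
have k3 : `|expR x| * `|cos y - 1| <= 3 * (a * m).
  by apply: ler_pM => //; lra.
have k4 : `|expR x - 1| * `|sin y| <= 2 * a * (2 * m) by apply: ler_pM.
have : a * m <= e / 16 * m by rewrite ler_wpM2r.
lra.
Qed.

Lemma derivable_cexp z : derivable (@cexp : C -> C) z 1.
Proof.
suff : is_derive z 1 (@cexp : C -> C) (cexp z) by case.
apply/is_derive_cmodP => e e0.
have E0 : 0 < expR (re z) := expR_gt0 _.
have [|d d0 H] := @cexp_expansion (e / expR (re z)); first by rewrite divr_gt0.
exists d => // w /H; set h := w - z => Hh.
have -> : cexp w - cexp z - cexp z * h = cexp z * (cexp h - 1 - h).
  by rewrite -[w](subrK z) -/h addrC cexpD; ring.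
rewrite cmodM cmod_cexp mulrC -ler_pdivlMr//.
by rewrite mulrAC.
Qed.

(** In logarithmic coordinates the circles of radii s and r are the vertical edges of a rectangle,
    so their means agree; then s tends to 0. These coordinates never reach the centre, where
    continuity is therefore enough. *)
Lemma circle_mean f z0 r rho : 0 < r -> r < rho ->
  (forall z, 0 < cmod (z - z0) < rho -> derivable f z 1) ->
  {for z0, continuous f} ->
  rint 0 (2 * pi) (fun t => re (f (circ z0 r t))) = re (f z0) * (2 * pi).
Proof.
move=> r0 rrho fd fc; set p := 2 * pi.
have p0 : 0 < p by rewrite /p mulr_gt0// pi_gt0.
pose G w : C := f (z0 + cexp w).
pose U x y := re (G (cpx x y)); pose V x y := - im (G (cpx x y)).
have GE s y : 0 < s -> G (cpx (ln s) y) = f (circ z0 s y).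
  by move=> s0; rewrite /G /cexp /re /im/= lnK.
have DF x y : x <= ln r -> divergence_free U V x y.
  move=> xr; have Gd : derivable G (cpx x y) 1.
    apply: (@derivable_comp _ f (fun w => z0 + cexp w)).
      by apply: derivableD; [exact: derivable_cst|exact: derivable_cexp].
    apply: fd; rewrite addrC addKr cmod_cexp expR_gt0/= (le_lt_trans _ rrho)//.
    by rewrite -[leRHS]lnK// ler_expR.
  have /is_derive_cmodP H : is_derive (cpx x y) 1 G ('D_1 G (cpx x y)).
    by split.
  move: H; set D := 'D_1 G (cpx x y) => H.
  (* Cauchy-Riemann: for G with derivative D, the x and y derivatives of re G are re D and - im D,
     those of - im G are - im D and - re D. *)
  exists (re D), (- im D), (- im D) => e e0.
  have [d d0 {}H] := H e e0; exists (d / 3); first lra.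
  move=> x' y' dx dy.
  have E : cpx x' y' - cpx x y = cpx (x' - x) (y' - y) by [].
  have := H (cpx x' y'); rewrite E.
  have h := cmod_cpx (x' - x) (y' - y).
  move=> /(_ ltac:(lra)) K.
  have {}K : cmod (G (cpx x' y') - G (cpx x y) - D * cpx (x' - x) (y' - y)) <=
    e * (`|x' - x| + `|y' - y|) by apply: (le_trans K); rewrite ler_wpM2l// ltW.
  split; apply: le_trans K.
    apply: le_trans (re_le _); rewrite !reB reM /U [re (cpx _ _)]/= [im (cpx _ _)]/=.
    by rewrite le_eqVlt; apply/orP; left; apply/eqP; congr `|_|; ring.
  apply: le_trans (im_le _); rewrite !imB imM /V [re (cpx _ _)]/= [im (cpx _ _)]/=.
  by rewrite le_eqVlt -normrN; apply/orP; left; apply/eqP; congr `|_|; ring.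
have mean_eq s : 0 < s -> s <= r ->
    rint 0 p (fun t => re (f (circ z0 s t))) = rint 0 p (fun t => re (f (circ z0 r t))).
  move=> s0 sr.
  have lsr : ln s <= ln r by rewrite ler_ln.
  have := @goursat R U V (ln s) (ln r) 0 p lsr (ltW p0).
  move=> /(_ (fun x y xi _ => DF x y (proj2 (andP xi)))).
  rewrite /flux.
  have -> : rint (ln s) (ln r) (V ^~ p) = rint (ln s) (ln r) (V ^~ 0).
    (* The horizontal edges cancel because the exponential has period 2 pi i. *)
    apply: eq_rint => x _; rewrite /V /G /cexp /re /im/= /expi.
    by rewrite /p mulr_natl cos2pi sin2pi cos0 sin0.
  have cancel (a b k : R) : a - b + (k - k) = 0 -> a = b by lra.
  move/cancel.
  rewrite (@eq_rint _ _ _ (U (ln r)) (fun t => re (f (circ z0 r t)))); last first.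
    by move=> t _; rewrite /U GE.
  rewrite (@eq_rint _ _ _ (U (ln s)) (fun t => re (f (circ z0 s t)))) => [->//|t _].
  by rewrite /U GE.
have cont s t : 0 < s -> s <= r -> {for t, continuous (fun t => re (f (circ z0 s t)))}.
  move=> s0 sr; apply: circ_mean_continuous; first exact: ltW.
  apply: derivable_continuous; apply: fd; rewrite cmod_circ; last exact: ltW.
  by rewrite s0 (le_lt_trans sr).
apply/eqP; rewrite -subr_eq0 -normr_le0; apply/ler_addgt0Pl => e e0; rewrite addr0.
have /continuous_cmodP fc' := fc.
have [|d d0 Hd] := fc' (e / p); first by rewrite divr_gt0.
pose s := Num.min r (d / 2).
have [s0 sr sd] : [/\ 0 < s, s <= r & s <= d / 2].
  by split; rewrite /s ?lt_min ?ge_min ?lexx ?orbT ?r0//=; lra.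
rewrite -(mean_eq s s0 sr).
have := @rint_near R 0 p _ (re (f z0)) (e / p) (ltW p0) (fun t _ => cont s t s0 sr).
rewrite subr0 divfK ?gt_eqF//; apply=> t _.
rewrite -reB (le_trans (re_le _))// Hd// cmod_circ; last exact: ltW.
by rewrite (le_lt_trans sd)//; lra.
Qed.

End CircleMean.

(** * Cauchy estimates and the second-order Taylor remainder *)

Section CauchyEstimates.
Context (R : realType).
Local Notation C := (CC R).
Implicit Types (z w a b D E : C) (f g df : C -> C) (r e t M rho : R).

Lemma is_deriveB_fun f g z D E : is_derive z 1 f D -> is_derive z 1 g E ->
  is_derive z 1 (fun w => f w - g w) (D - E).
Proof. by move=> fz gz; exact: is_deriveB. Qed.

Lemma is_deriveM_fun f g z D E : is_derive z 1 f D -> is_derive z 1 g E ->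
  is_derive z 1 (fun w => f w * g w) (f z * E + g z * D).
Proof. by move=> fz gz; exact: is_deriveM. Qed.

Lemma is_deriveZ_fun f z D a : is_derive z 1 f D ->
  is_derive z 1 (fun w => a * f w) (a * D).
Proof.
move=> fz; have := is_deriveM_fun (is_derive_cst a z 1) fz.
by rewrite mulr0 addr0.
Qed.

Lemma is_derive_shift f z a D : is_derive (z + a) 1 f D ->
  is_derive z 1 (fun w => f (w + a)) D.
Proof.
move=> /is_derive_cmodP H; apply/is_derive_cmodP => e e0.
have [d d0 Hd] := H e e0; exists d => // w wz.
have E' : w + a - (z + a) = w - z by ring.
by have := Hd (w + a); rewrite E'; exact.
Qed.

Lemma derivableB_fun f g z : derivable f z 1 -> derivable g z 1 ->
  derivable (fun w => f w - g w) z 1.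
Proof. by move=> fz gz; exact: derivableB. Qed.

Lemma derivableM_fun f g z : derivable f z 1 -> derivable g z 1 ->
  derivable (fun w => f w * g w) z 1.
Proof. by move=> fz gz; exact: derivableM. Qed.

Lemma derivableZ_fun f z a : derivable f z 1 -> derivable (fun w => a * f w) z 1.
Proof. by move=> fz; apply: derivableM_fun fz; exact: derivable_cst. Qed.

(** The difference quotient with its singularity at [a] removed: continuous at [a], derivable
    elsewhere, exactly what [circle_mean] accepts. *)
Definition dslope f a z : C := if z == a then 'D_1 f a else (f z - f a) / (z - a).

Lemma dslope_continuous f a : derivable f a 1 -> {for a, continuous (dslope f a)}.
Proof.
move=> fa; apply/continuous_cmodP => e e0.
have /is_derive_cmodP/(_ e e0)[d d0 H] : is_derive a 1 f ('D_1 f a).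
  exact: DeriveDef fa erefl.
exists d => // w /H; rewrite /dslope eqxx.
have [_|wa] := eqVneq w a; first by move=> _; rewrite subrr cmod0 ltW.
have wa0 : w - a != 0 by rewrite subr_eq0.
have -> : (f w - f a) / (w - a) - 'D_1 f a =
  (f w - f a - 'D_1 f a * (w - a)) / (w - a) by field.
by rewrite cmodM cmodV ler_pdivrMr ?cmod_gt0.
Qed.

Lemma near_dslope f a z : z != a ->
  {near z, (fun w => (f w - f a) / (w - a)) =1 dslope f a}.
Proof.
move=> za; apply/near_cmodP; exists (cmod (z - a)); first by rewrite cmod_gt0 subr_eq0.
move=> w; rewrite /dslope; have [->|//] := eqVneq w a.
by rewrite cmodC ltxx.
Qed.

Lemma dslope_derivable f a z : z != a -> derivable f z 1 -> derivable (dslope f a) z 1.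
Proof.
move=> za fz; apply: near_eq_derivable (near_dslope f za) _.
apply: derivableM_fun; first by apply: derivableB_fun fz _; exact: derivable_cst.
apply: derivableV; first by rewrite subr_eq0.
by apply: derivableB_fun; [exact: derivable_id|exact: derivable_cst].
Qed.

Lemma dslope_continuous_neq f a z : z != a -> {for z, continuous f} ->
  {for z, continuous (dslope f a)}.
Proof.
move=> za fz; have E := near_dslope f za.
have Ez : dslope f a z = (f z - f a) / (z - a) by rewrite /dslope (negbTE za).
rewrite /prop_for /continuous_at Ez.
apply: cvg_trans (near_eq_cvg E) _ => /=.
apply: cvgM; first by apply: cvgB; [exact: fz|exact: cvg_cst].
apply: cvgV; first by rewrite subr_eq0.
by apply: cvgB; [exact: cvg_id|exact: cvg_cst].
Qed.

(** After rotating [f a] onto the positive axis, its modulus is the mean of a real part that is at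
    most [M] on the circle. *)
Lemma circle_bound f a r rho M : 0 < r -> r < rho ->
  (forall z, 0 < cmod (z - a) < rho -> derivable f z 1) ->
  {for a, continuous f} ->
  (forall z, cmod (z - a) = r -> cmod (f z) <= M) -> cmod (f a) <= M.
Proof.
move=> r0 rrho fd fc fM; have [u u1 <-] := cmod_unit_re (f a).
have gd z : 0 < cmod (z - a) < rho -> derivable (fun w => u * f w) z 1.
  by move=> /fd; exact: derivableZ_fun.
have gc : {for a, continuous (fun w => u * f w)}.
  exact: (@continuousM C C (fun=> u) f a (@cst_continuous C C u a) fc).
have := @circle_mean R (fun w => u * f w) a r rho r0 rrho gd gc.
have p0 : 0 < 2 * pi :> R by rewrite mulr_gt0// pi_gt0.
have inr t : cmod (circ a r t - a) = r by rewrite cmod_circ// ltW.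
have := @rint_near R 0 (2 * pi) (fun t => re (u * f (circ a r t))) 0 M (ltW p0).
move=> H mean.
have : `|rint 0 (2 * pi) (fun t => re (u * f (circ a r t))) - 0 * (2 * pi - 0)| <=
    M * (2 * pi - 0).
  apply: H => t _.
    apply: (@circ_mean_continuous R (fun w => u * f w) a r t (ltW r0)).
    by apply: derivable_continuous; apply: gd; rewrite inr r0.
  by rewrite subr0 (le_trans (re_le _))// cmodM u1 mul1r fM.
rewrite mean mul0r !subr0 normrM (gtr0_norm p0) ler_pM2r//.
by apply: le_trans; exact: ler_norm.
Qed.

(** The derivative is the central value of [dslope f a], whose modulus on the circle is at most
    [M / r]. Bounding the increments rather than [f] lets Lipschitz bounds be fed in. *)
Lemma cauchy_estimate f a D r rho M : 0 < r -> r < rho ->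
  (forall z, cmod (z - a) < rho -> derivable f z 1) -> is_derive a 1 f D ->
  (forall z, cmod (z - a) = r -> cmod (f z - f a) <= M) -> cmod D <= M / r.
Proof.
move=> r0 rrho fd [fa <-] fM.
have -> : 'D_1 f a = dslope f a a by rewrite /dslope eqxx.
apply: (circle_bound r0 rrho).
- move=> z /andP[z0 zr]; apply: dslope_derivable; last exact: fd.
  by rewrite -subr_eq0 -cmod_gt0.
- exact: dslope_continuous.
- move=> z zr; rewrite /dslope; case: eqP => [za|_].
    by move: zr; rewrite za subrr cmod0 => r00; rewrite -r00 ltxx in r0.
  by rewrite cmodM cmodV zr ler_pdivlMr// divfK ?gt_eqF// fM.
Qed.

(** The increment is rotated onto the positive axis, and the real mean value theorem is applied to
    the real part along the segment. *)
Lemma mean_value_ineq f df a rho M z w :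
  (forall z, cmod (z - a) < rho -> is_derive z 1 f (df z)) ->
  (forall z, cmod (z - a) < rho -> cmod (df z) <= M) ->
  cmod (z - a) < rho -> cmod (w - a) < rho ->
  cmod (f z - f w) <= M * cmod (z - w).
Proof.
move=> fd fM za wa; have [u u1 <-] := cmod_unit_re (f z - f w).
pose p t := w + creal t * (z - w).
have pin t : 0 <= t <= 1 -> cmod (p t - a) < rho.
  move=> /andP[t0 t1].
  have -> : p t - a = creal (1 - t) * (w - a) + creal t * (z - a).
    by rewrite /p crealD crealN creal1; ring.
  apply: (le_lt_trans (cmodD _ _)); rewrite !cmodM !cmod_creal !ger0_norm//; last lra.
  have [->|t0'] := eqVneq t 0; first by rewrite subr0 mul1r mul0r addr0.
  have : 0 < t by rewrite lt_neqAle eq_sym t0'.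
  by move=> {}t0; nra.
pose phi t := re (u * f (p t)).
have phid t : t \in `[0, 1] -> is_derive t (1 : R) phi (re (u * df (p t) * (z - w))).
  rewrite in_itv/= => t01; have /fd/is_derive_cmodP H := pin t t01.
  apply/is_derive_expansion => e e0.
  have zw0 : 0 <= cmod (z - w) := cmod_ge0 _.
  (* The added 1 covers the case z = w. *)
  have [|d d0 Hd] := H (e / (cmod (z - w) + 1)); first by rewrite divr_gt0//; lra.
  have d'0 : 0 < d / (cmod (z - w) + 1) by rewrite divr_gt0//; lra.
  near=> h.
  have hd : `|h| < d / (cmod (z - w) + 1).
    rewrite -[h]subr0 distrC; near: h; exact: (@cvgr_dist_lt _ _ _ _ _ id 0).
  have E : p (t + h) - p t = creal h * (z - w) by rewrite /p crealD; ring.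
  have ph : cmod (p (t + h) - p t) = `|h| * cmod (z - w) by rewrite E cmodM cmod_creal.
  rewrite ltr_pdivlMr in hd; last lra.
  have {}hd : `|h| * cmod (z - w) < d by apply: le_lt_trans hd; rewrite ler_wpM2l//; lra.
  have := Hd (p (t + h)); rewrite ph => /(_ hd).
  rewrite E /phi => K.
  have -> : re (u * f (p (t + h))) - re (u * f (p t)) - re (u * df (p t) * (z - w)) * h =
      re (u * (f (p (t + h)) - f (p t) - df (p t) * (creal h * (z - w)))).
    rewrite (mulrBr u (_ - _)) (mulrBr u (f _)) !reB; congr (_ - _).
    have -> : u * (df (p t) * (creal h * (z - w))) = u * df (p t) * (z - w) * creal h by ring.
    by rewrite [RHS]reM [im (creal h)]/= mulr0 subr0.
  apply: (le_trans (re_le _)); rewrite cmodM u1 mul1r (le_trans K)//.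
  rewrite mulrAC ler_pdivrMr; last lra.
  by rewrite mulrA; have := mulr_ge0 (ltW e0) (normr_ge0 h); nra.
have phid' t : t \in `]0, 1[ -> is_derive t (1 : R) phi (re (u * df (p t) * (z - w))).
  by move=> t01; apply: phid; exact: (subset_itv_oo_cc t01).
have phic : {within [set` `[0, 1]], continuous phi}.
  apply: continuous_in_subspaceT => t; rewrite inE => /phid [pd _].
  by apply: differentiable_continuous; exact/derivable1_diffP.
have [c c01] := MVT_segment (@ler01 R) phid' phic.
rewrite subr0 mulr1 /phi /p creal0 creal1 mul0r mul1r addr0 subrKC.
rewrite -reB -mulrBr => ->.
apply: (le_trans (ler_norm _)); apply: (le_trans (re_le _)).
rewrite !cmodM u1 mul1r ler_wpM2r ?cmod_ge0//; apply: fM; apply: pin.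
by move: c01; rewrite in_itv.
Unshelve. all: by end_near. Qed.

(* The second-order remainder is controlled by the sup norm of f alone, because
   Cauchy estimates make first f and then f' Lipschitz. *)
Lemma taylor_remainder f df a rho M : 0 < rho ->
  (forall z, cmod (z - a) < rho -> is_derive z 1 f (df z)) ->
  (forall z, cmod (z - a) < rho -> cmod (f z) <= M) ->
  forall z, cmod (z - a) < rho / 8 ->
  cmod (f z - f a - df a * (z - a)) <= 256 * M / rho ^+ 2 * cmod (z - a) ^+ 2.
Proof.
move=> rho0 fd fM.
have tri x y b : cmod (x - y) <= cmod (x - b) + cmod (y - b).
  by rewrite (cmodC y) (le_trans _ (cmodD _ _))// addrA subrK.
have sub x y r : cmod (x - a) < r -> cmod (y - x) < rho - r -> cmod (y - a) < rho.
  by move=> xr yx; have := cmodD (y - x) (x - a); rewrite subrKA; lra.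
have dfM z : cmod (z - a) < rho / 2 -> cmod (df z) <= 8 * M / rho.
  move=> za.
  (* Cauchy estimate on the circle of radius [rho / 4] about [z], where the increments of [f] are at
     most [2 * M]. *)
  have -> : 8 * M / rho = (2 * M) / (rho / 4) by field; lra.
  apply: (@cauchy_estimate f z _ (rho / 4) (rho / 2)); [lra|lra| |apply: fd; lra|].
    move=> w wz; have /fd [] // : cmod (w - a) < rho.
    by apply: sub za _; lra.
  move=> w wz; have wa : cmod (w - a) < rho by apply: sub za _; lra.
  have := fM w wa; have := fM z ltac:(lra); have := cmodB (f w) (f z); lra.
have lip z w : cmod (z - a) < rho / 2 -> cmod (w - a) < rho / 2 ->
    cmod (f z - f w) <= 8 * M / rho * cmod (z - w).
  by apply: (@mean_value_ineq f df) => x xa; [apply: fd; lra|exact: dfM].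
have M0 : 0 <= M by apply: le_trans (cmod_ge0 (f a)) (fM _ _); rewrite subrr cmod0.
(* Cauchy estimate at [a] for [f (w + h) - f w] with [h = z - a]: by [lip] its increments are at
   most twice [8 * M / rho * cmod h], and the circle has radius [rho / 8]. *)
have dlip z : cmod (z - a) < rho / 4 ->
    cmod (df z - df a) <= 128 * M / rho ^+ 2 * cmod (z - a).
  move=> za; pose h := z - a.
  have shift w : cmod (w - a) < rho / 4 -> cmod (w + h - a) < rho / 2.
    by move=> wa; have := cmodD (w - a) h; rewrite addrAC /h; lra.
  have gd w : cmod (w - a) < rho / 4 ->
      is_derive w 1 (fun w => f (w + h) - f w) (df (w + h) - df w).
    move=> wa; apply: is_deriveB_fun; last by apply: fd; lra.
    by apply: is_derive_shift; apply: fd; have := shift w wa; lra.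
  have -> : 128 * M / rho ^+ 2 * cmod (z - a) = (16 * M / rho * cmod h) / (rho / 8).
    by rewrite -/h; field; lra.
  have -> : df z - df a = df (a + h) - df a by rewrite /h subrKC.
  apply: (@cauchy_estimate (fun w => f (w + h) - f w) a _ (rho / 8) (rho / 4));
    [lra|lra| |by apply: gd; rewrite subrr cmod0; lra|].
    by move=> w /gd[].
  move=> w wa.
  have lh x : cmod (x - a) < rho / 4 -> cmod (f (x + h) - f x) <= 8 * M / rho * cmod h.
    move=> xa; have := lip (x + h) x; rewrite (addrC x h) addrK; apply; last lra.
    by rewrite (addrC h); exact: shift.
  have l1 : cmod (f (w + h) - f w) <= 8 * M / rho * cmod h by apply: lh; lra.
  have l2 : cmod (f (a + h) - f a) <= 8 * M / rho * cmod h.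
    by apply: lh; rewrite subrr cmod0; lra.
  have := cmodB (f (w + h) - f w) (f (a + h) - f a); lra.
move=> z za.
have [->|zna] := eqVneq z a.
  by rewrite !subrr mulr0 subrr cmod0 expr0n/= mulr0.
set m := cmod (z - a); have m0 : 0 < m by rewrite cmod_gt0 subr_eq0.
(* The remainder is the increment of [psi] from [a] to [z]. The open disc of radius [2 * m] contains
   [z] and, as [m < rho / 8], lies where [dlip] holds; this turns 128 into 256. *)
pose psi w := f w - df a * w.
have psid w : cmod (w - a) < 2 * m -> is_derive w 1 psi (df w - df a).
  move=> wa; apply: is_deriveB_fun; first by apply: fd; rewrite /m in wa *; lra.
  by have := is_deriveZ_fun (df a) (is_derive_id w 1); rewrite mulr1.
have psiM w : cmod (w - a) < 2 * m -> cmod (df w - df a) <= 128 * M / rho ^+ 2 * (2 * m).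
  move=> wa; apply: (le_trans (dlip w _)); first by rewrite /m in wa *; lra.
  by apply: ler_wpM2l; [apply: divr_ge0; [lra|apply: exprn_ge0; lra]|exact: ltW].
have := @mean_value_ineq psi (fun w => df w - df a) a (2 * m) _ z a psid psiM.
rewrite subrr cmod0 -/m => /(_ ltac:(lra) ltac:(lra)).
have -> : psi z - psi a = f z - f a - df a * (z - a) by rewrite /psi; ring.
by move=> /le_trans; apply; rewrite le_eqVlt; apply/orP; left; apply/eqP; field; lra.
Qed.

End CauchyEstimates.

(** * Mean value property and maximum principle, with isolated exceptional points *)

Section MaximumPrinciple.
Context (R : realType).
Local Notation C := (CC R).
Implicit Types (z w a b : C) (f g h : C -> C) (r e t M rho : R).

Let two_pi_gt0 : 0 < 2 * pi :> R.
Proof. by rewrite mulr_gt0// pi_gt0. Qed.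

(** A substitute for holomorphy that passes to uniform limits. The factor [c] encodes the complex
    mean by real integrals and allows rotations. *)
Definition mean_value_property g :=
  (forall t, {for circ 0 1 t, continuous g}) /\
  (forall c, rint 0 (2 * pi) (fun t => re (c * g (circ 0 1 t))) =
    re (c * g 0) * (2 * pi)).

Lemma continuousZ c g z : {for z, continuous g} -> {for z, continuous (fun w => c * g w)}.
Proof. by move=> gz; exact: (@continuousM C C (fun=> c) g z (@cst_continuous C C c z) gz). Qed.

Lemma continuous_subr a z : {for z, continuous (fun w => w - a)}.
Proof.
apply: derivable_continuous; apply: derivableB_fun; last exact: derivable_cst.
exact: derivable_id.
Qed.

Lemma derivable_mean_value_property g rho : 1 < rho ->
  (forall z, cmod z < rho -> derivable g z 1) -> mean_value_property g.
Proof.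
move=> rho1 gd; split=> [t|c].
  apply: derivable_continuous; apply: gd.
  by have := cmod_circ 0 t (@ler01 R); rewrite subr0 => ->.
apply: (@circle_mean R (fun w => c * g w) 0 1 rho) => //.
  by move=> z; rewrite subr0 => /andP[_ zr]; apply: derivableZ_fun; exact: gd.
apply: continuousZ; apply: derivable_continuous; apply: gd.
by rewrite cmod0 (lt_trans ltr01).
Qed.

Lemma mean_value_property_lim g : (forall t, {for circ 0 1 t, continuous g}) ->
  (forall e, 0 < e -> exists2 h, mean_value_property h &
    cmod (h 0 - g 0) <= e /\ forall t, cmod (h (circ 0 1 t) - g (circ 0 1 t)) <= e) ->
  mean_value_property g.
Proof.
move=> gc gh; split=> // c.
have cont k t : {for circ 0 1 t, continuous k} ->
    {for t, continuous (fun t => re (c * k (circ 0 1 t)))}.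
  by move=> /(@continuousZ c k _); exact: (@circ_mean_continuous R
    (fun w => c * k w) 0 1 t ler01).
apply/eqP; rewrite -subr_eq0 -normr_le0; apply/ler_addgt0Pl => e e0; rewrite addr0.
have c0 := cmod_ge0 c.
(* Each of the two replacements of [h] by [g], on the circle and at the centre, then costs at most
   [e / 2]. *)
pose d := e / (2 * pi) / 2 / (cmod c + 1).
have d0 : 0 < d by rewrite !divr_gt0//; lra.
have [h [hc hm] [h0 ht]] := gh d d0.
have cd : cmod c * d <= e / (2 * pi) / 2.
  rewrite /d mulrC -[leRHS](@divfK _ (cmod c + 1)); last by rewrite gt_eqF//; lra.
  by apply: ler_wpM2l; [exact: (ltW d0)|lra].
set I := rint _ _ _; set J := re _.
have H1 : `|rint 0 (2 * pi) (fun t =>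
      re (c * g (circ 0 1 t)) - re (c * h (circ 0 1 t))) - 0 * (2 * pi - 0)|
    <= (e / (2 * pi) / 2) * (2 * pi - 0).
  apply: rint_near => [|t _|t _]; first exact: ltW.
    by apply: cvgB; [exact: (cont g t (gc t))|exact: (cont h t (hc t))].
  rewrite subr0 -reB -mulrBr (le_trans (re_le _))// cmodM cmodC (le_trans _ cd)//.
  by rewrite ler_wpM2l.
rewrite rintB in H1; last 2 first.
- by move=> t _; exact: (cont g t (gc t)).
- by move=> t _; exact: (cont h t (hc t)).
rewrite mul0r !subr0 hm -/I in H1.
have H2 : `|re (c * h 0) - J| <= e / (2 * pi) / 2.
  by rewrite -reB -mulrBr (le_trans (re_le _))// cmodM (le_trans _ cd)// ler_wpM2l.
have H3 : `|(re (c * h 0) - J) * (2 * pi)| <= e / (2 * pi) / 2 * (2 * pi).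
  by rewrite normrM (gtr0_norm two_pi_gt0) ler_pM2r.
have -> : I - J * (2 * pi) = (I - re (c * h 0) * (2 * pi)) + (re (c * h 0) - J) * (2 * pi) by ring.
apply: (le_trans (ler_normD _ _)).
have -> : e = e / (2 * pi) / 2 * (2 * pi) + e / (2 * pi) / 2 * (2 * pi).
  by have pi0 := pi_gt0 R; field; lra.
exact: lerD.
Qed.

Lemma circ_pi : circ 0 1 (pi : R) = - 1.
Proof.
rewrite /circ add0r creal1 mul1r /expi cospi sinpi.
by apply/eqP; rewrite eq_complex/= oppr0 !eqxx.
Qed.

(** Equality case of the mean inequality for the real part of the rotated [g]. The point -1 has
    parameter pi, interior to the interval of integration. *)
Lemma mean_value_property_max g : mean_value_property g ->
  (forall t, cmod (g (circ 0 1 t)) <= cmod (g 0)) -> g (- 1) = g 0.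
Proof.
move=> [gc gm] gmax; have [c c1 cg] := cmod_unit_re (g 0).
have pi0 := pi_gt0 R.
have H : {in `]0, 2 * pi[, forall t, re (c * g (circ 0 1 t)) = cmod (g 0)}.
  apply: rint_ge_eq.
  - move=> t _; apply: (@circ_mean_continuous R (fun w => c * g w) 0 1 t ler01).
    exact: continuousZ.
  - move=> t _; apply: (le_trans (ler_norm _)); apply: (le_trans (re_le _)).
    by rewrite cmodM c1 mul1r.
  - by rewrite gm cg subr0.
have {}H : re (c * g (- 1)) = cmod (g 0).
  rewrite -circ_pi.
  by apply: H; rewrite in_itv/= pi0; lra.
have g1 : cmod (g (- 1)) <= cmod (g 0).
  rewrite -circ_pi.
  exact: gmax.
(* A complex number whose real part is at least its modulus has zero imaginary part. *)
have cval x : cmod x <= cmod (g 0) -> re (c * x) = cmod (g 0) -> c * x = creal (cmod (g 0)).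
  move=> x1 x2; rewrite [LHS]cpx_eta x2.
  have : cmod (c * x) ^+ 2 <= cmod (g 0) ^+ 2.
    by rewrite cmodM c1 mul1r ler_pXn2r// nnegrE cmod_ge0.
  rewrite cmodE x2 gerDl => im0.
  have /eqP : im (c * x) ^+ 2 = 0 by apply/eqP; rewrite eq_le im0 sqr_ge0.
  by rewrite sqrf_eq0 => /eqP ->.
have c0 : c != 0 by rewrite -cmod_gt0 c1.
by apply: (mulfI c0); rewrite (cval _ g1 H) (cval _ (lexx _) cg).
Qed.

Lemma cmod_continuous : continuous (@cmod R : C -> R).
Proof.
move=> z; apply/(@cvgrPdist_le _ _ _ _ (nbhs_filter z)) => e e0.
apply/near_cmodP; exists e => // w wz.
have h1 := cmodD (z - w) w; have h2 := cmodD (w - z) z; rewrite !subrK in h1 h2.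
by rewrite (cmodC z) in h1; rewrite ler_norml; apply/andP; split; lra.
Qed.

Lemma cpx_continuous : continuous (fun p : R * R => cpx p.1 p.2 : C).
Proof.
move=> p; apply/cvgrPdist_le => _ /gt0_creal[e e0 ->].
have e2 : 0 < e / 2 by lra.
have /cvgrPdist_le/(_ _ e2) c1 : q.1 @[q --> p] --> p.1 by exact: cvg_fst.
have /cvgrPdist_le/(_ _ e2) c2 : q.2 @[q --> p] --> p.2 by exact: cvg_snd.
near=> q; rewrite normCmod creal_le.
have -> : cpx p.1 p.2 - cpx q.1 q.2 = cpx (p.1 - q.1) (p.2 - q.2) by [].
have h1 : `|p.1 - q.1| <= e / 2 by near: q.
have h2 : `|p.2 - q.2| <= e / 2 by near: q.
by have := cmod_cpx (p.1 - q.1) (p.2 - q.2); lra.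
Unshelve. all: by end_near. Qed.

(** Compactness of the disc comes from a real square, carried to the complex plane by [P]. *)
Lemma disc_max a rho (v : C -> R) : 0 <= rho ->
  (forall z, cmod (z - a) <= rho -> {for z, continuous v}) ->
  exists2 m, cmod (m - a) <= rho & forall z, cmod (z - a) <= rho -> v z <= v m.
Proof.
move=> rho0 vc.
pose P (p : R * R) : C := a + cpx p.1 p.2.
have Pc : continuous P.
  by move=> p; apply: cvgD; [exact: cvg_cst|exact: cpx_continuous].
pose K : set (R * R) := [set p | cmod (P p - a) <= rho].
have KE p : cmod (P p - a) = cmod (cpx p.1 p.2) by rewrite /P addrC addKr.
have Kclosed : closed K.
  have -> : K = (fun p => cmod (P p - a)) @^-1` [set x | x <= rho] by [].
  apply: closed_comp; last exact: closed_le.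
  move=> p _; apply: (@continuous_comp _ _ _ (fun p => P p - a) (@cmod R));
    last exact: cmod_continuous.
  by apply: cvgB; [exact: Pc|exact: cvg_cst].
have Kc : compact K.
  apply: (subclosed_compact Kclosed (compact_setX
    (@segment_compact R (- rho) rho) (@segment_compact R (- rho) rho))).
  move=> p; rewrite /K/= KE => pr; split; rewrite /= in_itv/= -ler_norml (le_trans _ pr)//.
    exact: (re_le (cpx p.1 p.2)).
  exact: (im_le (cpx p.1 p.2)).
have K0 : K !=set0.
  exists (0, 0); have -> : K (0, 0) = (cmod (P (0, 0) - a) <= rho) by [].
  by rewrite KE (_ : cpx _ _ = 0) ?cmod0.
have Kv : {within K, continuous (v \o P)}.
  apply: continuous_in_subspaceT => p; rewrite inE => Kp.
  by apply: continuous_comp; [exact: Pc|exact: vc].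
have [p] := compact_EVT_max K0 Kc Kv.
rewrite inE => Kp pmax; exists (P p) => // z za.
have Pz : P (re (z - a), im (z - a)) = z by rewrite /P/= -cpx_eta subrKC.
rewrite -[in leLHS]Pz; apply: pmax.
by rewrite inE /K/= Pz.
Qed.

(* For small e > 0 the function |f|^2 + e |z - a|^2 is strictly subharmonic, so
   it has no interior maximum. *)
Lemma maximum_principle f a rho M : 0 <= rho ->
  (forall z, cmod (z - a) <= rho -> {for z, continuous f}) ->
  (forall z, cmod (z - a) < rho -> exists2 d, 0 < d &
    forall w, 0 < cmod (w - z) < d -> derivable f w 1) ->
  (forall z, cmod (z - a) = rho -> cmod (f z) <= M) ->
  forall z, cmod (z - a) <= rho -> cmod (f z) <= M.
Proof.
move=> rho0 fc fd fM z za.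
have bound e : 0 < e -> cmod (f z) ^+ 2 <= `|M| ^+ 2 + e * rho ^+ 2.
  move=> e0; pose v w := cmod (f w) ^+ 2 + e * cmod (w - a) ^+ 2.
  have vc w : cmod (w - a) <= rho -> {for w, continuous v}.
    move=> wa; have cs (k : C -> C) : {for w, continuous k} ->
        {for w, continuous (fun w => cmod (k w) ^+ 2)}.
      move=> kc; have ck : {for w, continuous (@cmod R \o k)}.
        by apply: continuous_comp; [exact: kc|exact: cmod_continuous].
      rewrite (_ : (fun _ => _) = (fun w => (@cmod R \o k) w * (@cmod R \o k) w)); last first.
        by apply/funext => x; rewrite /= expr2.
      exact: (@continuousM R C _ _ w ck ck).
    have c1 := cs _ (fc w wa).
    have c2 : {for w, continuous (fun w => cmod (w - a) ^+ 2)}.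
      by apply: (cs (fun w => w - a)); exact: continuous_subr.
    apply: (@continuousD R R C _ _ w c1).
    exact: (@continuousM R C _ _ w (@cst_continuous C R e w) c2).
  have [m mr mmax] := disc_max rho0 vc.
  have [mlt|mge] := ltP (cmod (m - a)) rho; last first.
    have ma : cmod (m - a) = rho by apply/eqP; rewrite eq_le mr mge.
    have := mmax z za; rewrite /v ma.
    have h1 := fM _ ma.
    have h2 : cmod (f m) ^+ 2 <= `|M| ^+ 2.
      by rewrite ler_pXn2r ?nnegrE ?cmod_ge0// (le_trans h1)// ler_norm.
    have h3 : 0 <= e * cmod (z - a) ^+ 2 by rewrite mulr_ge0 ?sqr_ge0// ltW.
    lra.
  exfalso; have [d d0 fd'] := fd m mlt.
  pose rho' := Num.min d (rho - cmod (m - a)).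
  have rho'0 : 0 < rho' by rewrite lt_min d0/=; lra.
  have [rho'd rho'r] : rho' <= d /\ rho' <= rho - cmod (m - a).
    by split; rewrite /rho' ge_min lexx ?orbT.
  pose r := rho' / 2.
  have [r0 rr] : 0 < r /\ r < rho' by rewrite /r; split; lra.
  pose conj (x : C) := cpx (re x) (- im x).
  have conjE (x y : C) : re (conj x * y) = re x * re y + im x * im y.
    by rewrite reM mulNr opprK.
  pose c := conj (f m); pose b := conj (m - a).
  (* Expanding the squares, [v w - v m] is twice the real part of [H w] plus |f w - f m|^2 + e |w -
     m|^2. At a maximum [m] the real part is at most [- (e * r ^+ 2 / 2)] on the circle, while its
     mean is that of [H m = 0]. *)
  pose H w : C := c * (f w - f m) + creal e * (b * (w - m)).
  have Hd w : 0 < cmod (w - m) < rho' -> derivable H w 1.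
    move=> /andP[w0 wr]; apply: derivableD.
      apply: derivableZ_fun; apply: derivableB_fun; last exact: derivable_cst.
      by apply: fd'; rewrite w0 (lt_le_trans wr).
    apply: derivableZ_fun; apply: derivableZ_fun.
    by apply: derivableB_fun; [exact: derivable_id|exact: derivable_cst].
  have Hc : {for m, continuous H}.
    have h1 : {for m, continuous (fun w => c * (f w - f m))}.
      apply: (@continuousZ c (fun w => f w - f m)).
      exact: (@continuousB C C C f (fun=> f m) m (fc m mr) (@cst_continuous C C (f m) m)).
    have h2 : {for m, continuous (fun w => creal e * (b * (w - m)))}.
      apply: (@continuousZ (creal e) (fun w => b * (w - m))).
      by apply: (@continuousZ b (fun w => w - m)); exact: continuous_subr.
    exact: (@continuousD C C C _ _ m h1 h2).
  have := @circle_mean R H m r rho' r0 rr Hd Hc.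
  have -> : H m = 0 by rewrite /H !subrr !mulr0 addr0.
  rewrite [re 0]/= mul0r => mean.
  have inr t : cmod (circ m r t - m) = r by rewrite cmod_circ// ltW.
  have Hle t : re (H (circ m r t)) <= - (e * r ^+ 2 / 2).
    set w := circ m r t.
    have wa : cmod (w - a) <= rho.
      have := cmodD (w - m) (m - a); rewrite subrKA inr; lra.
    have := mmax w wa; rewrite /v.
    have er : re (creal e) = e by []. have ei : im (creal e) = 0 by [].
    have /esym wm := cmodE (w - m); rewrite inr in wm.
    rewrite !cmodE /H (reD (c * _)) (reM (creal e)) er ei mul0r subr0 /c /b !conjE.
    move: wm; rewrite !reB !imB.
    have := sqr_ge0 (re (f w) - re (f m)); have := sqr_ge0 (im (f w) - im (f m)).
    set fwr := re (f w); set fwi := im (f w); set fmr := re (f m); set fmi := im (f m).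
    set wr := re w; set wi := im w; set mr' := re m; set mi := im m.
    set ar := re a; set ai := im a => g1 g2 g3 g4.
    have -> : e * r ^+ 2 = e * ((wr - mr') ^+ 2 + (wi - mi) ^+ 2) by rewrite g3.
    lra.
  have cst (k : R) : {in `[0, 2 * pi], continuous (fun=> k)}.
    by move=> t _; exact: cvg_cst.
  have := @ler_rint R 0 (2 * pi) (fun t => re (H (circ m r t))) (fun=> - (e * r ^+ 2 / 2)).
  rewrite mean rint_cst ?subr0; last exact: ltW.
  have er2 : 0 < e * r ^+ 2 / 2 by rewrite divr_gt0// mulr_gt0// exprn_gt0.
  have : - (e * r ^+ 2 / 2) * (2 * pi) < 0 by rewrite nmulr_rlt0// oppr_lt0.
  move=> neg; move=> /(_ _ _ _) K.
  have : 0 <= - (e * r ^+ 2 / 2) * (2 * pi).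
    apply: K => t _; [|exact: cvg_cst|exact: Hle].
    apply: circ_mean_continuous; first exact: ltW.
    by apply: derivable_continuous; apply: Hd; rewrite inr r0.
  by rewrite leNgt neg.
have M0 : `|M| = M.
  rewrite ger0_norm//; have := fM (a + creal rho); rewrite addrC addKr cmod_creal ger0_norm//.
  by move=> /(_ erefl); apply: le_trans; exact: cmod_ge0.
rewrite -M0 -(@ler_pXn2r _ 2)// ?nnegrE ?cmod_ge0//.
apply/ler_addgt0Pr => e e0.
(* Since [bound] holds for every positive tolerance, its term in [rho ^+ 2] can be made smaller than
   any [e]. *)
apply: (le_trans (bound (e / (rho ^+ 2 + 1)) _)).
  by rewrite divr_gt0// ltr_wpDl// sqr_ge0.
rewrite lerD2l mulrAC ler_pdivrMr; last by rewrite ltr_wpDl// sqr_ge0.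
by rewrite ler_wpM2l ?ltW//; lra.
Qed.

End MaximumPrinciple.

(** * Zeros of holomorphic functions of one variable *)

Section IsolatedZeros.
Context (R : realType).
Local Notation C := (CC R).
Implicit Types (z w a : C) (f g : C -> C) (r e M rho : R) (s E : seq C).

Lemma punctured_disc_avoids s a :
  exists2 d, 0 < d & forall w, 0 < cmod (w - a) < d -> w \notin s.
Proof.
elim: s => [|b s [d d0 Hd]]; first by exists 1.
have [->|ba] := eqVneq b a.
  exists d => // w /[dup] /andP[wa _] /Hd ws; rewrite inE negb_or ws andbT.
  by apply: contraTneq wa => ->; rewrite subrr cmod0 ltxx.
exists (Num.min d (cmod (b - a))); first by rewrite lt_min d0 cmod_gt0 subr_eq0.
move=> w /andP[w0]; rewrite lt_min => /andP[wd wb].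
rewrite inE negb_or Hd ?w0// andbT.
by apply: contraTneq wb => ->; rewrite ltxx.
Qed.

(* Dividing out the zeros one at a time, the quotient stays continuous, and the
   maximum principle transfers its bound from the circle to the small disc. *)
Lemma zeros_bound s : forall g E a r M, 0 < r -> 0 <= M ->
  (forall z, cmod (z - a) <= r -> {for z, continuous g}) ->
  (forall z, cmod (z - a) < r -> z \notin E -> derivable g z 1) ->
  uniq s -> (forall w, w \in s -> [/\ cmod (w - a) < r / 8, g w = 0 & w \notin E]) ->
  (forall z, cmod (z - a) = r -> cmod (g z) <= M) ->
  forall z, cmod (z - a) < r / 8 -> cmod (g z) <= M / 2 ^+ size s.
Proof.
elim: s => [|w s IH] g E a r M r0 M0 gc gd us gs gM z za.
  rewrite expr0 divr1; apply: (maximum_principle (ltW r0) gc) (gM) _ _; last lra.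
  move=> x xa; have [d d0 Hd] := punctured_disc_avoids E x.
  exists (Num.min d (r - cmod (x - a))); first by rewrite lt_min d0 subr_gt0.
  move=> y /andP[y0]; rewrite lt_min => /andP[yd yr].
  apply: gd; last by apply: Hd; rewrite y0.
  by have := cmodD (y - x) (x - a); rewrite subrKA; lra.
have [wa gw wE] := gs w (mem_head _ _).
move: us => /= /andP[ws us].
have gdw : derivable g w 1 by apply: gd => //; lra.
pose k := dslope g w.
have kE x : x != w -> k x = g x / (x - w).
  by move=> xw; rewrite /k /dslope (negbTE xw) gw subr0.
(* The zero [w] is within [r / 8] of the centre, hence at distance at least [7 * r / 8] from the
   circle. *)
have kM x : cmod (x - a) = r -> cmod (k x) <= M / (7 * r / 8).
  move=> xa; have h := cmodD (x - w) (w - a); rewrite subrKA xa in h.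
  have xw : x != w by apply/eqP => xw; move: xa; rewrite xw; lra.
  rewrite kE// cmodM cmodV; apply: ler_pM; rewrite ?invr_ge0 ?cmod_ge0//; first exact: gM.
  by rewrite lef_pV2 ?posrE ?cmod_gt0 ?subr_eq0//; lra.
have K : cmod (k z) <= M / (7 * r / 8) / 2 ^+ size s.
  (* [E] collects the zeros already divided out, where the quotient is only known to be
     continuous. *)
  apply: (IH k (w :: E) a r) za; [exact: r0| | | |exact: us| |exact: kM].
  - by apply: divr_ge0; [exact: M0|lra].
  - move=> x xa; have [->|xw] := eqVneq x w; first exact: dslope_continuous.
    by apply: dslope_continuous_neq xw _; exact: gc.
  - move=> x xa; rewrite inE negb_or => /andP[xw xE].
    by apply: dslope_derivable xw _; exact: gd.
  - move=> x xs; have [xa gx xE] := gs x (@mem_behead _ (w :: s) x xs).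
    have xw : x != w by apply: contraNneq ws => <-.
    by split => //; rewrite ?kE// ?gx ?mul0r// inE negb_or xw.
have gk : cmod (g z) = cmod (z - w) * cmod (k z).
  have [->|zw] := eqVneq z w; first by rewrite gw subrr cmod0 mul0r.
  by rewrite kE// -cmodM mulrC divfK// subr_eq0.
have zw : cmod (z - w) <= r / 4.
  by have := cmodB (z - a) (w - a); rewrite opprB addrA subrK; lra.
have P0 : 0 < 2 ^+ size s :> R by rewrite exprn_gt0.
rewrite gk exprS.
apply: (@le_trans _ _ (r / 4 * (M / (7 * r / 8) / 2 ^+ size s))).
  by apply: ler_pM => //; exact: cmod_ge0.
(* Each zero gains the factor [(r / 4) / (7 * r / 8)], below one half. *)
have -> : r / 4 * (M / (7 * r / 8) / 2 ^+ size s) = 2 / 7 * (M / 2 ^+ size s).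
  by field; lra.
have -> : M / (2 * 2 ^+ size s) = 1 / 2 * (M / 2 ^+ size s) by field; lra.
by apply: ler_wpM2r; [apply: divr_ge0 => //; exact: ltW|lra].
Qed.

(** Any number n of zeros is available in the disc of radius [r / 8], so [zeros_bound] gives |f| <=
    M / 2^n there for every n. *)
Lemma zero_near_accumulation f a rho : 0 < rho ->
  (forall z, cmod (z - a) < rho -> derivable f z 1) ->
  (forall e, 0 < e -> exists z, 0 < cmod (z - a) < e /\ f z = 0) ->
  exists2 e, 0 < e & forall z, cmod (z - a) < e -> f z = 0.
Proof.
move=> rho0 fd acc.
have /continuous_cmodP/(_ 1 ltr01)[d d0 Hd] : {for a, continuous f}.
  by apply: derivable_continuous; apply: fd; rewrite subrr cmod0.
pose r := Num.min d rho / 2.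
have m0 : 0 < Num.min d rho by rewrite lt_min d0.
have [md mr] : Num.min d rho <= d /\ Num.min d rho <= rho.
  by split; rewrite ge_min lexx ?orbT.
have [r0 rd rrho] : [/\ 0 < r, r < d & r < rho] by rewrite /r; split; lra.
pose M := cmod (f a) + 1.
have M0 : 0 <= M by have := cmod_ge0 (f a); rewrite /M; lra.
exists (r / 8); first lra.
have zs n : exists s, [/\ size s = n, uniq s &
    forall w, w \in s -> [/\ cmod (w - a) < r / 8, f w = 0 & w \notin [::]]].
  elim: n => [|n [s [sn us sz]]]; first by exists [::].
  have [e e0 He] := punctured_disc_avoids s a.
  have [|z [/andP[z0]]] := acc (Num.min e (r / 8)); first by rewrite lt_min e0/=; lra.
  rewrite lt_min => /andP[ze zr] fz.
  exists (z :: s); split; rewrite /= ?sn ?us ?andbT//; first by apply: He; rewrite z0.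
  by move=> w; rewrite inE => /predU1P[->|/sz].
move=> z za.
have bound n : cmod (f z) <= M / 2 ^+ n.
  have [s [<- us sz]] := zs n.
  apply: (@zeros_bound s f [::] a r M r0 M0 _ _ us sz _ z za) => x xa.
  - by apply: derivable_continuous; apply: fd; lra.
  - by move=> _; apply: fd; lra.
  - have := Hd x; rewrite xa => /(_ rd) h.
    by have := cmodD (f x - f a) (f a); rewrite subrK /M; lra.
apply/eqP; rewrite -cmod_eq0 eq_le cmod_ge0 andbT leNgt; apply/negP => fz.
have [n nM] : exists n : nat, M / cmod (f z) < n%:R.
  exists (Num.bound (M / cmod (f z))); apply: archi_boundP.
  by apply: divr_ge0 => //; exact: cmod_ge0.
have := bound n; rewrite leNgt => /negP; apply.
rewrite ltr_pdivrMr ?exprn_gt0// mulrC -ltr_pdivrMr//.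
by rewrite (lt_trans nM)// -natrX ltr_nat ltn_expl.
Qed.

End IsolatedZeros.

(** * Chain rule and complex lines in charts *)

Lemma derive_comp_jacobian (K : numFieldType) m n (r : K -> 'rV[K]_m)
    (T : 'rV[K]_m -> 'rV[K]_n) (t : K) :
  derivable r t 1 -> differentiable T (r t) ->
  'D_1 (T \o r) t = 'D_1 r t *m 'J T (r t).
Proof.
move=> /derivable1_diffP dr Td.
have -> : 'D_1 (T \o r) t = 'd (T \o r) t 1.
  by apply: deriveE; exact: differentiable_comp.
have -> : 'D_1 r t = 'd r t 1 by exact: deriveE.
rewrite mul_rV_lin1; exact: (congr1 (@^~ 1) (diff_comp dr Td)).
Qed.

Section ChartLines.
Context (R : realType).
Local Notation C := (CC R).

Lemma derivable_diffP (V : normedModType C) (f : C -> V) (t : C) :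
  derivable f t 1 <-> differentiable f t.
Proof. exact: derivable1_diffP. Qed.

Lemma derivable_diff_comp (V W : normedModType C) (f : C -> V) (g : V -> W) (t : C) :
  derivable f t 1 -> differentiable g (f t) -> derivable (g \o f) t 1.
Proof.
move=> /derivable_diffP fd gd; apply/derivable_diffP; exact: (differentiable_comp fd gd).
Qed.

Lemma differentiable_affine n (b u : 'rV[C]_n) (t : C) :
  differentiable (fun t : C => b + t *: u) t.
Proof.
apply: differentiableD; first exact: differentiable_cst.
by apply: differentiableZl; exact/(@derivable_diffP C)/derivable_id.
Qed.

Section Chart.
Context (n : nat) (T : topologicalType) (phi : chart R n T).
Implicit Types (y : T) (u v : 'rV[C]_n) (t : C).

Definition chart_image : set 'rV[C]_n := phi @` chart_dom phi.

(** A complex line in coordinates, meaningful only while its argument stays in [chart_image]. *)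
Definition line y u t : T := chart_inv phi (phi y + t *: u).

Lemma chart_invK v : chart_image v ->
  chart_dom phi (chart_inv phi v) /\ phi (chart_inv phi v) = v.
Proof. by move=> [x xd <-]; rewrite chart_mapK. Qed.

Lemma chart_inv_continuous_at v : chart_image v -> {for v, continuous (chart_inv phi)}.
Proof. by move=> [x xd <-]; exact: chart_inv_continuous. Qed.

Lemma chart_image_map y : chart_dom phi y -> chart_image (phi y).
Proof. by exists y. Qed.

Lemma near_chart_dom y : chart_dom phi y -> \forall x \near y, chart_dom phi x.
Proof. by move=> yd; apply: open_nbhs_nbhs; split=> //; exact: chart_dom_open. Qed.

Lemma near_chart_image v : chart_image v -> \forall x \near v, chart_image x.
Proof. by move=> yd; apply: open_nbhs_nbhs; split=> //; exact: chart_codom_open. Qed.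

Lemma line0 y u : chart_dom phi y -> line y u 0 = y.
Proof. by move=> yd; rewrite /line scale0r addr0 chart_mapK. Qed.

Lemma line_continuous y u t : chart_image (phi y + t *: u) ->
  {for t, continuous (line y u)}.
Proof.
move=> im; apply: (@continuous_comp _ _ _ (fun t => phi y + t *: u) (chart_inv phi)).
  exact: (differentiable_continuous (differentiable_affine (phi y) u t)).
exact: chart_inv_continuous_at.
Qed.

Lemma line_shift y u t s : chart_image (phi y + t *: u) ->
  line (line y u t) u s = line y u (t + s).
Proof.
by move=> /chart_invK[_ E]; rewrite /line E scalerDl addrA.
Qed.

(** Radius 2 leaves room around the closed unit disc, and the parameter -1 is where
    [mean_value_property_max] concludes. *)
Lemma near_line y0 (N : set T) : chart_dom phi y0 -> nbhs y0 N ->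
  \forall y \near y0, chart_dom phi y /\ exists u, line y0 u (- 1) = y /\
    forall t, cmod t < 2 -> chart_image (phi y0 + t *: u) /\ N (line y0 u t).
Proof.
move=> y0d yN.
have : nbhs (phi y0) (chart_image `&` chart_inv phi @^-1` N).
  apply: filterI; first exact/near_chart_image/chart_image_map.
  by apply: (chart_inv_continuous y0d); rewrite chart_mapK.
move=> /nbhs_ballP[_ /= /gt0_creal[e e0 ->] He].
have e20 : 0 < creal (e / 2) by rewrite creal_gt0 divr_gt0.
have yc : \forall y \near y0, `|phi y0 - phi y| < creal (e / 2).
  by have /cvgrPdist_lt := chart_map_continuous y0d; exact.
near=> y.
have yd : chart_dom phi y by near: y; exact: near_chart_dom.
(* This direction has norm below [e / 2], so parameters below 2 stay within [e]. *)
split=> //; exists (phi y0 - phi y); split.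
  by rewrite /line scaleN1r opprB addrC subrK chart_mapK.
move=> t t2.
apply: He; rewrite -ball_normE /ball_/= opprD addNKr normrN normrZ.
have ye : `|phi y0 - phi y| < creal (e / 2) by near: y.
rewrite normCmod -[e](@divfK _ 2)// mulrC crealM.
have [->|u0] := eqVneq (phi y0 - phi y) 0.
  by rewrite normr0 mul0r -crealM creal_gt0 mulr_gt0// divr_gt0.
apply: (@lt_trans _ _ (`|phi y0 - phi y| * creal 2)).
  by rewrite ltr_pM2l ?normr_gt0// creal_lt.
by rewrite ltr_pM2r// creal_gt0.
Unshelve. all: by end_near. Qed.

End Chart.

Lemma holomorphic_line m n (M : complexManifold R m) (N : complexManifold R n)
    (h : M -> N) (phi : chart R m M) (psi : chart R n N) y u t :
  holomorphic h -> atlas phi -> atlas psi ->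
  chart_image phi (phi y + t *: u) -> chart_dom psi (h (line phi y u t)) ->
  derivable (psi \o h \o line phi y u) t 1.
Proof.
move=> [_ hh] aphi apsi im hd.
apply: (@derivable_diff_comp _ _ (fun t => phi y + t *: u) (psi \o h \o chart_inv phi)).
  by apply/derivable_diffP; exact: differentiable_affine.
have [d E] := chart_invK im.
by rewrite /= -[X in differentiable _ X]E; exact: hh.
Qed.

Lemma is_derive_entry m n (q : C -> 'M[C]_(m, n)) (t : C) i j :
  derivable q t 1 -> is_derive t 1 (fun t => q t i j) (('D_1 q t) i j).
Proof.
move=> qd; have cq : {for 'D_1 q t, continuous (fun M : 'M[C]_(m, n) => M i j)}.
  exact: coord_continuous.
have H : h^-1 *: ((q (h *: 1 + t)) i j - q t i j) @[h --> (0 : C)^'] --> ('D_1 q t) i j.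
  have := cvg_comp _ _ qd cq; apply: cvg_trans; apply: near_eq_cvg.
  by apply: nearW => h /=; rewrite !mxE.
by split; [apply/cvg_ex; eexists; exact: H|exact: cvg_lim H].
Qed.

End ChartLines.

(** * Locally constant maps on connected spaces *)

Section Connectedness.
Context (T : topologicalType).

Lemma connected_clopen (S : set T) : connected [set: T] -> S !=set0 -> open S -> closed S ->
  S = setT.
Proof.
by move=> cT S0 So Sc; apply: cT => //; exists S; rewrite ?setTI.
Qed.

Lemma near_const_connected (U : Type) (h : T -> U) : connected [set: T] ->
  (forall y0, \forall y \near y0, h y = h y0) -> forall y y', h y = h y'.
Proof.
move=> cT hc y y'; pose S := [set x | h x = h y'].
have So : open S by rewrite openE => x Sx; near=> z; rewrite /S/= -Sx; near: z; exact: hc.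
have Sc : closed S.
  rewrite -openC openE => x nSx; near=> z; rewrite /setC/= /S/=.
  by have -> : h z = h x by near: z; exact: hc.
have E := connected_clopen cT (ex_intro _ y' erefl) So Sc.
by have : S y by rewrite E.
Unshelve. all: by end_near. Qed.

End Connectedness.

(** * Values of holomorphic 1-forms on tangent vectors of curves *)

Section FormsAlongCurves.
Context (R : realType) (X : complexManifold R 1).
Local Notation C := (CC R).
Implicit Types (w : holomorphicForm X) (q : C -> X) (x : X) (t : C).

Definition chart_at x : chart R 1 X := s2val (cid2 (atlas_cover x)).

Lemma chart_at_atlas x : atlas (chart_at x).
Proof. exact: (s2valP (cid2 (atlas_cover x))). Qed.

Lemma chart_at_dom x : chart_dom (chart_at x) x.
Proof. exact: (s2valP' (cid2 (atlas_cover x))). Qed.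

(** The curve stands for its tangent vector at 0, so regularity is asked at that parameter only. *)
Definition holomorphic_curve q := {for 0, continuous q} /\
  forall psi : chart R 1 X, atlas psi -> chart_dom psi (q 0) -> derivable (psi \o q) 0 1.

(* The value of w on the tangent vector q'(0). *)
Definition form_on w q : C :=
  ('D_1 (chart_at (q 0) \o q) 0 *m w (chart_at (q 0)) (q 0)) 0 0.

(** Independence of the chart: the Jacobian from the chain rule is the one absorbed by
    [form_compatible]. One chart can thus serve all nearby curves. *)
Lemma form_onE w q (psi : chart R 1 X) : holomorphic_curve q -> atlas psi ->
  chart_dom psi (q 0) ->
  form_on w q = 'D_1 (fun s => psi (q s) 0 0) 0 * w psi (q 0) 0 0.
Proof.
move=> [qc qd] apsi xd; rewrite /form_on.
set psi0 := chart_at (q 0); set x := q 0.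
have a0 := chart_at_atlas x; have d0 := chart_at_dom x.
set T := transition psi psi0; set r := psi \o q.
have rd : derivable r 0 1 by exact: qd.
have Td : differentiable T (r 0) by exact: atlas_holomorphic.
have E : {near (0 : C), (T \o r) =1 (psi0 \o q)}.
  have : \forall s \near (0 : C), chart_dom psi (q s) := qc _ (near_chart_dom xd).
  by apply: filterS => s sd; rewrite /T /r /transition /= chart_mapK.
have -> : 'D_1 (psi0 \o q) 0 = 'D_1 r 0 *m 'J T (r 0).
  rewrite -(near_eq_derive _ E).
  have dr : differentiable r 0 by exact/derivable_diffP.
  exact: derive_comp_jacobian.
rewrite -mulmxA -(form_compatible w apsi a0 xd d0).
rewrite mxE big_ord1; congr (_ * _).
by have [_ E'] := is_derive_entry 0 0 rd; exact: esym.
Qed.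

Lemma form_coef_continuous w (psi : chart R 1 X) x : atlas psi -> chart_dom psi x ->
  {for x, continuous (fun x => w psi x 0 0)}.
Proof.
move=> apsi xd.
have c1 : {for x, continuous ((w psi \o chart_inv psi) \o psi)}.
  apply: continuous_comp; first exact: chart_map_continuous.
  exact/differentiable_continuous/form_holomorphic.
have c2 : {for x, continuous (fun x => ((w psi \o chart_inv psi) \o psi) x 0 0)}.
  apply: (@continuous_comp _ _ _ ((w psi \o chart_inv psi) \o psi) (fun M : 'cV[C]_1 => M 0 0)) => //.
  exact: coord_continuous.
have E : {near x, (fun x => ((w psi \o chart_inv psi) \o psi) x 0 0) =1 (fun x => w psi x 0 0)}.
  by apply: filterS (near_chart_dom xd) => z zd /=; rewrite chart_mapK.
have Ex : w psi x 0 0 = ((w psi \o chart_inv psi) \o psi) x 0 0 by rewrite /= chart_mapK.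
rewrite /prop_for /continuous_at Ex.
exact: cvg_trans (near_eq_cvg E) c2.
Qed.

Section Lines.
Context (n : nat) (Y : complexManifold R n) (h : Y -> X) (hh : holomorphic h).
Context (phi : chart R n Y) (aphi : atlas phi).

Lemma line_holomorphic_curve y u : chart_dom phi y -> holomorphic_curve (h \o line phi y u).
Proof.
move=> yd; have im : chart_image phi (phi y + 0 *: u).
  by rewrite scale0r addr0; exact: chart_image_map.
split.
  apply: (@continuous_comp _ _ _ (line phi y u) h); first exact: line_continuous.
  exact: (proj1 hh).
by move=> psi apsi xd; exact: (holomorphic_line hh aphi apsi im xd).
Qed.

Lemma form_line_derivable w (psi : chart R 1 X) y u t : atlas psi ->
  chart_image phi (phi y + t *: u) -> chart_dom psi (h (line phi y u t)) ->
  derivable (fun t => w psi (h (line phi y u t)) 0 0) t 1.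
Proof.
move=> apsi im xd; set q := line phi y u.
have qd := holomorphic_line hh aphi apsi im xd.
have c1 : derivable ((w psi \o chart_inv psi) \o (psi \o h \o q)) t 1.
  by apply: (derivable_diff_comp qd); exact: form_holomorphic.
have [c2 _] := is_derive_entry 0 0 c1.
apply: near_eq_derivable c2.
have qc : {for t, continuous (h \o q)}.
  apply: (@continuous_comp _ _ _ q h); first exact: line_continuous.
  exact: (proj1 hh).
have : \forall s \near t, chart_dom psi (h (q s)) := qc _ (near_chart_dom xd).
by apply: filterS => s sd /=; rewrite chart_mapK.
Qed.

End Lines.
End FormsAlongCurves.

(** * The pullback of a form in one factor is constant along the other *)

Section PullbackConstant.
Context (R : realType) (X : complexManifold R 1).
Local Notation C := (CC R).
Context (n1 n2 : nat) (Y1 : complexManifold R n1) (Y2 : complexManifold R n2).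
Context (f : Y1 -> Y2 -> X).
Hypothesis f_continuous : continuous (fun p : Y1 * Y2 => f p.1 p.2).
Hypothesis f_hol1 : forall y2, holomorphic (f ^~ y2).
Hypothesis f_hol2 : forall y1, holomorphic (f y1).
Context (w : holomorphicForm X) (phi : chart R n1 Y1) (aphi : atlas phi).
Context (a : Y1) (ad : chart_dom phi a) (v : 'rV[C]_n1).

(* The pullback of w by f, evaluated at (a, y) on the vector (v, 0). *)
Let A (y : Y2) : C := form_on w (fun s => f (line phi a v s) y).

(** Joint continuity gives one radius [r] valid for all [y] in [N]; this makes the Taylor bound
    uniform in [y]. *)
Let near_slice (y0 : Y2) (G : set X) : nbhs (f a y0) G ->
  exists2 r, 0 < r & exists2 N : set Y2, nbhs y0 N & forall s y, cmod s < r -> N y ->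
    chart_image phi (phi a + s *: v) /\ G (f (line phi a v s) y).
Proof.
move=> Gx; have im0 : chart_image phi (phi a + 0 *: v).
  by rewrite scale0r addr0; exact: chart_image_map.
have lc := line_continuous im0.
have : nbhs (line phi a v 0, y0) [set p | G (f p.1 p.2)].
  by apply: f_continuous; rewrite /= line0.
move=> [[P Q] /= [/lc Pn Qn] PQ].
have /near_cmodP[r1 r10 H1] : \forall s \near (0 : C), P (line phi a v s) by exact: Pn.
have /near_cmodP[r2 r20 H2] : \forall s \near (0 : C), chart_image phi (phi a + s *: v).
  apply: (differentiable_continuous (differentiable_affine (phi a) v 0)).
  exact: near_chart_image.
exists (Num.min r1 r2); first by rewrite lt_min r10.
exists Q => // s y; rewrite lt_min => /andP[s1 s2] Qy; split; first by apply: H2; rewrite subr0.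
by apply: (PQ (_, _)); split => //=; apply: H1; rewrite subr0.
Qed.

(** [B] replaces the derivative in s by a difference quotient, which is holomorphic along lines in
    [y] because each slice of f is. By [taylor_remainder] the error is uniform on [N], and [N] is
    fixed before [e]. *)
Let local_approximation (y0 : Y2) : exists2 N : set Y2, nbhs y0 N &
  forall e, 0 < e -> exists B : Y2 -> C,
    [/\ forall y, N y -> cmod (B y - A y) <= e,
        forall y, N y -> {for y, continuous B} &
        forall (psi : chart R n2 Y2) b u t, atlas psi ->
          chart_image psi (psi b + t *: u) -> N (line psi b u t) ->
          derivable (B \o line psi b u) t 1].
Proof.
set x0 := f a y0; pose psi := chart_at x0.
have apsi := chart_at_atlas x0; have dpsi := chart_at_dom x0.
rewrite -/psi in apsi dpsi.
pose z x := psi x 0 0; pose k x := w psi x 0 0.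
have zc x : chart_dom psi x -> {for x, continuous z}.
  move=> xd; apply: (@continuous_comp _ _ _ psi (fun M : 'rV[C]_1 => M 0 0)).
    exact: chart_map_continuous.
  exact: coord_continuous.
have kc x : chart_dom psi x -> {for x, continuous k} by exact: form_coef_continuous.
pose G := [set x | chart_dom psi x /\ (cmod (z x) <= cmod (z x0) + 1 /\
  cmod (k x) <= cmod (k x0) + 1)].
have bdd (g : X -> C) : {for x0, continuous g} ->
    \forall x \near x0, cmod (g x) <= cmod (g x0) + 1.
  move=> gc; have : \forall x \near x0, `|g x0 - g x| <= creal 1.
    by have /cvgrPdist_le := gc; apply; rewrite creal_gt0.
  apply: filterS => x; rewrite normCmod creal_le cmodC => h.
  by have := cmodD (g x - g x0) (g x0); rewrite subrK; lra.
have Gn : nbhs x0 G.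
  apply: filterI; first exact: near_chart_dom.
  by apply: filterI; [exact: bdd (zc _ dpsi)|exact: bdd (kc _ dpsi)].
have [r r0 [N Nn H]] := near_slice Gn.
set M := cmod (z x0) + 1; set K := cmod (k x0) + 1.
have M0 : 0 <= M by have := cmod_ge0 (z x0); rewrite /M; lra.
have K0 : 0 <= K by have := cmod_ge0 (k x0); rewrite /K; lra.
exists N => // e e0.
pose F y s := z (f (line phi a v s) y).
have Fd y s : N y -> cmod s < r -> is_derive s 1 (F y) ('D_1 (F y) s).
  move=> Ny sr; have [im [xd _]] := H s y sr Ny.
  have := holomorphic_line (f_hol1 y) aphi apsi im xd.
  by move=> /(is_derive_entry 0 0) [Fd _]; apply: DeriveDef Fd erefl.
have AE y : N y -> A y = 'D_1 (F y) 0 * k (f a y).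
  move=> Ny; have [|im [xd _]] := H 0 y _ Ny; first by rewrite cmod0.
  rewrite /A (@form_onE _ _ w _ psi)//; first by rewrite line0.
  exact: (line_holomorphic_curve (f_hol1 y) aphi v ad).
pose L := 256 * M / r ^+ 2.
have L0 : 0 <= L.
  by apply: divr_ge0; [apply: mulr_ge0; [lra|exact: M0]|apply: exprn_ge0; lra].
have KL0 : 0 <= K * L by apply: mulr_ge0.
(* The first bound puts the increment inside the radius [r / 8] of [taylor_remainder]; the second
   makes the error [K * L * s] at most [e]. *)
pose s := Num.min (r / 16) (e / (K * L + 1)).
have s0 : 0 < s by rewrite lt_min !divr_gt0//; lra.
have [sr se] : s <= r / 16 /\ s <= e / (K * L + 1).
  by split; rewrite /s ge_min lexx ?orbT.
have scm : cmod (creal s) = s by rewrite cmod_creal gtr0_norm.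
have sne : creal s != 0 by rewrite -cmod_gt0 scm.
have sin : cmod (creal s) < r by rewrite scm; lra.
exists (fun y => k (f a y) * ((F y (creal s) - F y 0) / creal s)); split.
- move=> y Ny; rewrite (AE y Ny).
  have T := @taylor_remainder R (F y) (fun s => 'D_1 (F y) s) 0 r M r0.
  have {}T : cmod (F y (creal s) - F y 0 - 'D_1 (F y) 0 * creal s) <= L * s ^+ 2.
    have := T _ _ (creal s); rewrite !subr0 scm; apply; last lra.
      by move=> t; rewrite subr0 => tr; exact: Fd.
    by move=> t; rewrite subr0 => tr; have [_ [_ []]] := H t y tr Ny.
  have -> : k (f a y) * ((F y (creal s) - F y 0) / creal s) - 'D_1 (F y) 0 * k (f a y) =
      k (f a y) * ((F y (creal s) - F y 0 - 'D_1 (F y) 0 * creal s) / creal s).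
    have alg (k' x d s' : C) : s' != 0 -> k' * (x / s') - d * k' = k' * ((x - d * s') / s').
      by move=> s'0; field.
    exact: alg.
  rewrite !cmodM cmodV scm.
  have kK : cmod (k (f a y)) <= K.
    have [|_ [_ []]] := H 0 y _ Ny; first by rewrite cmod0.
    by rewrite (line0 v ad).
  apply: (@le_trans _ _ (K * (L * s))).
    apply: ler_pM => //; first exact: cmod_ge0.
      by apply: divr_ge0; [exact: cmod_ge0|exact: ltW].
    by rewrite ler_pdivrMr// -mulrA -expr2.
  rewrite ler_pdivlMr in se; last lra.
  by nra.
- move=> y Ny.
  have Fc t : cmod t < r -> {for y, continuous (fun y => F y t)}.
    move=> tr; have [_ [xd _]] := H t y tr Ny.
    apply: (@continuous_comp _ _ _ (f (line phi a v t)) z); last exact: zc.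
    exact: (proj1 (f_hol2 _)).
  have c1 := Fc _ sin; have [|_ [xd _]] := H 0 y _ Ny; first by rewrite cmod0.
  rewrite (line0 v ad) in xd.
  have c2 : {for y, continuous (fun y => F y 0)} by apply: Fc; rewrite cmod0.
  have c3 : {for y, continuous (fun y => k (f a y))}.
    apply: (@continuous_comp _ _ _ (f a) k); last exact: kc.
    exact: (proj1 (f_hol2 _)).
  have c4 := @continuousB C C Y2 _ _ y c1 c2.
  have c5 := @continuousM C Y2 _ _ y c4 (@cst_continuous Y2 C (creal s)^-1 y).
  exact: (@continuousM C Y2 _ _ y c3 c5).
- move=> phi2 b u t aphi2 im Nt; set q := line phi2 b u.
  have Fd2 t' : cmod t' < r -> derivable (fun t => F (q t) t') t 1.
    move=> tr; have [_ [xd _]] := H t' _ tr Nt.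
    have := holomorphic_line (f_hol2 _) aphi2 apsi im xd.
    by move=> /(is_derive_entry 0 0) [].
  have [|_ [xd _]] := H 0 _ _ Nt; first by rewrite cmod0.
  rewrite (line0 v ad) in xd.
  apply: derivableM_fun.
    exact: (form_line_derivable (f_hol2 a) aphi2 apsi im xd).
  apply: derivableM_fun; last exact: derivable_cst.
  by apply: derivableB_fun; apply: Fd2; rewrite ?cmod0.
Qed.

Let cmod_third (x y z : C) (e : R) :
  cmod x <= e / 3 -> cmod y <= e / 3 -> cmod z <= e / 3 -> cmod (x - y + z) <= e.
Proof. by have := cmodD (x - y) z; have := cmodB x y; lra. Qed.

Let A_continuous : continuous A.
Proof.
move=> y0; have [N Nn H] := local_approximation y0.
apply/(@cvgrPdist_le _ _ _ _ (nbhs_filter y0)) => _ /gt0_creal[e e0 ->].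
have [|B [BA Bc _]] := H (e / 3); first lra.
have Ny0 : N y0 := nbhs_singleton Nn.
have Bn : \forall y \near y0, `|B y0 - B y| <= creal (e / 3).
  by have /cvgrPdist_le := Bc _ Ny0; apply; rewrite creal_gt0; lra.
near=> y.
have Ny : N y by near: y.
have h : cmod (B y0 - B y) <= e / 3 by rewrite -creal_le -normCmod; near: y.
rewrite normCmod creal_le.
have h1 := BA y0 Ny0; have h2 := BA y Ny.
have -> : A y0 - A y = (B y0 - B y) - (B y0 - A y0) + (B y - A y) by ring.
exact: (cmod_third h h1 h2).
Unshelve. all: by end_near. Qed.

Let A_mean_value (y0 : Y2) : \forall y \near y0, exists g : C -> C,
  [/\ mean_value_property g, g 0 = A y0, g (- 1) = A y &
      forall t, exists y', g t = A y'].
Proof.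
have [N Nn H] := local_approximation y0.
have [psi2 apsi2 d2] := atlas_cover y0.
apply: filterS (near_line d2 Nn) => y [yd [u [uy Hu]]].
exists (A \o line psi2 y0 u); split.
- apply: mean_value_property_lim.
    move=> t; have := cmod_circ 0 t (@ler01 R); rewrite subr0 => c1.
    have [|im _] := Hu (circ 0 1 t); first by rewrite c1; lra.
    apply: (@continuous_comp _ _ _ (line psi2 y0 u) A); first exact: line_continuous.
    exact: A_continuous.
  move=> e e0; have [B [BA _ Bd]] := H e e0.
  exists (B \o line psi2 y0 u).
    apply: (@derivable_mean_value_property R _ 2); first lra.
    by move=> t t2; have [im Nt] := Hu t t2; exact: Bd.
  split=> [|t]; apply: BA; apply: (proj2 (Hu _ _)); first by rewrite cmod0.
  by have := cmod_circ 0 t (@ler01 R); rewrite subr0 => ->; lra.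
- by rewrite /= line0.
- by rewrite /= uy.
- by move=> t; exists (line psi2 y0 u t).
Qed.

(** Strong maximum principle: the set where [A] takes the value at a point of maximal modulus is
    closed, and open by the mean value property on lines. *)
Lemma pullback_constant : compact [set: Y2] -> connected [set: Y2] ->
  forall y y', form_on w (fun s => f (line phi a v s) y) =
               form_on w (fun s => f (line phi a v s) y').
Proof.
move=> cpt conn y y'; change (A y = A y').
have ne : [set: Y2] !=set0 by exists y.
have cA : {within [set: Y2], continuous (fun y => cmod (A y))}.
  apply: continuous_in_subspaceT => x _.
  apply: (@continuous_comp _ _ _ A (@cmod R)); [exact: A_continuous|exact: cmod_continuous].
have [m _ mmax] := compact_EVT_max ne cpt cA.
pose S := [set x | A x = A m].
have So : open S.
  rewrite openE => x Sx; apply: filterS (A_mean_value x) => x' [g [gm g0 g1 gA]].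
  rewrite /S/= -Sx -g0 -g1; apply: mean_value_property_max => // t.
  by have [y'' ->] := gA (circ 0 1 t); rewrite g0 Sx; apply: mmax; rewrite inE.
have Sc : closed S.
  have -> : S = A @^-1` [set A m] by [].
  apply: closed_comp; first by move=> x _; exact: A_continuous.
  exact: accessible_closed_set1 (hausdorff_accessible (@norm_hausdorff C C)) _.
have E := connected_clopen conn (ex_intro _ m erefl) So Sc.
have Sy x : A x = A m by have : S x by rewrite E.
by rewrite !Sy.
Qed.

End PullbackConstant.

(** * Zeros of forms, and maps along which a form vanishes *)

Section FormZeros.
Context (R : realType) (X : complexManifold R 1).
Local Notation C := (CC R).
Implicit Types (w : holomorphicForm X) (x : X) (psi : chart R 1 X).

Definition form_zero w x := forall psi, atlas psi -> chart_dom psi x -> w psi x = 0.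

Lemma mx11_eq (M N : 'M[C]_1) : M 0 0 = N 0 0 -> M = N.
Proof. by move=> E; apply/matrixP => i j; rewrite !ord1. Qed.

Lemma form_zeroP w x psi : atlas psi -> chart_dom psi x -> w psi x 0 0 = 0 ->
  form_zero w x.
Proof.
move=> apsi xd wx psi' apsi' xd'; rewrite (form_compatible w apsi' apsi xd' xd).
by rewrite (@mx11_eq (w psi x) 0) ?mulmx0// mxE.
Qed.

(** [zero_near_accumulation] for the coefficient of [w] in one chart, with row vectors of length 1
    identified with scalars by [row]. *)
Lemma form_zero_dichotomy w x :
  (\forall x' \near x, form_zero w x') \/
  (\forall x' \near x, x' = x \/ ~ form_zero w x').
Proof.
pose psi := chart_at x; have apsi : atlas psi := chart_at_atlas x.
have xd : chart_dom psi x := chart_at_dom x.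
pose row (z : C) : 'rV[C]_1 := 0 + z *: const_mx 1.
have rowE (v : 'rV[C]_1) : row (v 0 0) = v.
  by apply: mx11_eq; rewrite !mxE mulr1 add0r.
have row_entry z : row z 0 0 = z by rewrite !mxE mulr1 add0r.
have rowd z : differentiable row z by exact: differentiable_affine.
pose z0 := psi x 0 0; pose k z := w psi (chart_inv psi (row z)) 0 0.
have [rho rho0 Hrho] : exists2 rho, 0 < rho & forall z, cmod (z - z0) < rho ->
    chart_image psi (row z).
  apply/near_cmodP; apply: (differentiable_continuous (rowd z0)).
  by rewrite rowE; apply: near_chart_image; exact: chart_image_map.
have kd z : cmod (z - z0) < rho -> derivable k z 1.
  move=> /Hrho im; have [d E] := chart_invK im.
  have c1 : derivable ((w psi \o chart_inv psi) \o row) z 1.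
    apply: derivable_diff_comp; first by apply/derivable_diffP; exact: rowd.
    by rewrite -E; exact: form_holomorphic.
  by have [] := is_derive_entry 0 0 c1.
have kE x' : chart_dom psi x' -> k (psi x' 0 0) = w psi x' 0 0.
  by move=> d; rewrite /k rowE chart_mapK.
have nearz e : 0 < e -> \forall x' \near x, cmod (psi x' 0 0 - z0) < e.
  move=> e0; have c : {for x, continuous (fun x => psi x 0 0)}.
    apply: (@continuous_comp _ _ _ psi (fun M : 'rV[C]_1 => M 0 0)).
      exact: chart_map_continuous.
    exact: coord_continuous.
  have : \forall x' \near x, `|z0 - psi x' 0 0| < creal e.
    by have /cvgrPdist_lt := c; apply; rewrite creal_gt0.
  by apply: filterS => x'; rewrite normCmod creal_lt cmodC.
have [acc|nacc] := pselect (forall e, 0 < e -> exists z, 0 < cmod (z - z0) < e /\ k z = 0).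
  left; have [e e0 He] := zero_near_accumulation rho0 kd acc.
  near=> x'; have d : chart_dom psi x' by near: x'; exact: near_chart_dom.
  apply: (form_zeroP apsi d); rewrite -kE//; apply: He.
  by near: x'; exact: nearz.
right; have [e [e0 He]] : exists e, 0 < e /\ forall z, 0 < cmod (z - z0) < e -> k z <> 0.
  apply: contrapT => H; apply: nacc => e e0; apply: contrapT => H'; apply: H.
  by exists e; split=> // z ze kz; apply: H'; exists z.
near=> x'; have d : chart_dom psi x' by near: x'; exact: near_chart_dom.
have [xx|xx] := pselect (x' = x); [by left|right => wx'].
apply: (He (psi x' 0 0)); last by rewrite kE// wx'// mxE.
apply/andP; split; last by near: x'; exact: nearz.
rewrite cmod_gt0 subr_eq0; apply/eqP => E; apply: xx.
by rewrite -(chart_mapK d) (mx11_eq E) chart_mapK.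
Unshelve. all: by end_near. Qed.

Definition isolated_form_zeros w :=
  forall x, \forall x' \near x, x' = x \/ ~ form_zero w x'.

(** Identity theorem: by the dichotomy, the points near which [w] vanishes identically form a closed
    as well as open set. *)
Lemma nonzero_form_isolated_zeros w : connected [set: X] ->
  (exists x, ~ form_zero w x) -> isolated_form_zeros w.
Proof.
move=> conn [x1 nz] x.
pose S : set X := [set z | nbhs z (form_zero w)].
have So : open S by rewrite openE => y Sy; exact: (nbhs_interior Sy).
have Sc : closed S.
  rewrite -openC openE => y nSy.
  have [//|] := form_zero_dichotomy w y.
  apply: filterS => x' [->//|nz'] Sx'; apply: nz'; exact: (nbhs_singleton Sx').
have [Sx|//] := form_zero_dichotomy w x.
have E := connected_clopen conn (ex_intro _ x Sx) So Sc.
have : S x1 by rewrite E.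
by move=> /nbhs_singleton.
Qed.

Lemma image_in_zeros_const (T : topologicalType) w (h : T -> X) :
  connected [set: T] -> continuous h -> isolated_form_zeros w ->
  (forall y, form_zero w (h y)) -> forall y y', h y = h y'.
Proof.
move=> conn hc iso hz; apply: near_const_connected => // y0.
have : \forall y \near y0, h y = h y0 \/ ~ form_zero w (h y) := hc _ _ (iso (h y0)).
by apply: filterS => y [].
Qed.

(* In a chart where the image point has coordinate 0, the coordinate g of h
   satisfies g * g' = 0 along lines, since w does not vanish where g does not;
   hence g ^+ 2 is constant. *)
Lemma pullback_zero_const n (Y : complexManifold R n) w (h : Y -> X) :
  connected [set: Y] -> holomorphic h -> isolated_form_zeros w ->
  (forall (phi : chart R n Y) y u, atlas phi -> chart_dom phi y ->
    form_on w (h \o line phi y u) = 0) ->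
  forall y y', h y = h y'.
Proof.
move=> conn hh iso H; apply: near_const_connected => // y0.
set x0 := h y0; pose psi := chart_at x0.
have apsi : atlas psi := chart_at_atlas x0; have xd : chart_dom psi x0 := chart_at_dom x0.
have Nn : nbhs y0 [set y | chart_dom psi (h y) /\ (h y = x0 \/ ~ form_zero w (h y))].
  have : nbhs x0 [set x | chart_dom psi x /\ (x = x0 \/ ~ form_zero w x)].
    by apply: filterI; [exact: near_chart_dom|exact: iso].
  exact: (proj1 hh).
have [phi aphi yd] := atlas_cover y0.
apply: filterS (near_line yd Nn) => y [_ [u [uy Hu]]].
pose z t := psi (h (line phi y0 u t)) 0 0.
pose g t := z t - psi x0 0 0.
have zd t : cmod t < 2 -> is_derive t 1 z ('D_1 z t).
  move=> t2; have [im [d _]] := Hu t t2.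
  have [D _] := is_derive_entry 0 0 (holomorphic_line hh aphi apsi im d).
  exact: DeriveDef D erefl.
have gd t : cmod t < 2 -> is_derive t 1 g ('D_1 z t).
  move=> t2; have := is_deriveB_fun (zd t t2) (is_derive_cst (psi x0 0 0) t 1).
  by rewrite subr0.
have gg t : cmod t < 2 -> g t * 'D_1 z t = 0.
  move=> t2; have [im [d [hx|nz]]] := Hu t t2.
    by rewrite /g /z hx subrr mul0r.
  have [ld lE] := chart_invK im; rewrite -/(line phi y0 u t) in ld lE.
  have := H phi (line phi y0 u t) u aphi ld.
  have curve := line_holomorphic_curve hh aphi u ld.
  have q0 : line phi (line phi y0 u t) u 0 = line phi y0 u t by exact: line0.
  rewrite (form_onE w curve apsi) /= ?q0// => /eqP.
  rewrite mulf_eq0 => /orP[/eqP D0|/eqP w0]; last first.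
    by exfalso; apply: nz; exact: (form_zeroP apsi d w0).
  suff -> : 'D_1 z t = 0 by rewrite mulr0.
  have zs : is_derive (0 : C) (1 : C) (fun s : C => z (s + t)) ('D_1 z t).
    by apply: is_derive_shift; rewrite add0r; exact: zd.
  (* [H] speaks of parameter 0 only; restarting the line at its point of parameter [t] makes it give
     the derivative of [z] at [t]. *)
  have fE : (fun s : C => psi (h (line phi (line phi y0 u t) u s)) 0 0) = (fun s => z (s + t)).
    by apply/funext => s; rewrite /z addrC -line_shift.
  by case: zs => _ <-; rewrite -fE.
(* The square of [g] has derivative 0 on the disc of radius 2, so its values at 0 and -1 agree. *)
have G0 : cmod (g (- 1) * g (- 1) - g 0 * g 0) <= 0 * cmod (- 1 - 0).
  apply: (@mean_value_ineq R (fun t => g t * g t) (fun=> 0) 0 2).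
  - move=> t; rewrite subr0 => t2.
    have := is_deriveM_fun (gd t t2) (gd t t2).
    by rewrite (gg t t2) addr0.
  - by move=> t _; rewrite cmod0.
  - by rewrite subr0 cmodN cmod1; lra.
  - by rewrite subrr cmod0.
have g0 : g 0 = 0 by rewrite /g /z line0// subrr.
move: G0; rewrite mul0r g0 mul0r subr0 => G0.
have /eqP : cmod (g (- 1) * g (- 1)) = 0 by apply/eqP; rewrite eq_le G0 cmod_ge0.
rewrite cmod_eq0 mulf_eq0 orbb /g /z uy subr_eq0 => /eqP E.
have [|_ [d _]] := Hu (- 1); first by rewrite cmodN cmod1; lra.
rewrite uy in d.
by rewrite -(chart_mapK d) (mx11_eq E) chart_mapK.
Qed.

End FormZeros.

(** * Linear combinations of forms *)

Section LinearCombinations.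
Context (R : realType) (n : nat) (M : complexManifold R n).
Local Notation C := (CC R).
Context (a b : C) (w w' : holomorphicForm M).

Let coef (phi : chart R n M) (x : M) : 'cV[C]_n := a *: w phi x + b *: w' phi x.

Fact lincomb_holomorphic phi : atlas phi -> forall x, chart_dom phi x ->
  differentiable (coef phi \o chart_inv phi) (phi x).
Proof.
move=> aphi x xd; apply: differentiableD; apply: differentiableZ.
  exact: (form_holomorphic w aphi xd).
exact: (form_holomorphic w' aphi xd).
Qed.

Fact lincomb_compatible phi psi : atlas phi -> atlas psi ->
  forall x, chart_dom phi x -> chart_dom psi x ->
  coef phi x = 'J (transition phi psi) (phi x) *m coef psi x.
Proof.
move=> aphi apsi x xd xd'; rewrite /coef (form_compatible w aphi apsi xd xd').
by rewrite (form_compatible w' aphi apsi xd xd') mulmxDr -!scalemxAr.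
Qed.

Definition lincomb_form : holomorphicForm M :=
  HolomorphicForm lincomb_holomorphic lincomb_compatible.

End LinearCombinations.

Lemma lincomb_form_neq0 (R : realType) (X : complexManifold R 1) (g : nat)
    (w : 'I_g -> holomorphicForm X) (i j : 'I_g) (a b : CC R) :
  (forall c : 'I_g -> CC R, is_lincomb_form w c (fun _ _ => 0) -> forall k, c k = 0) ->
  i != j -> a != 0 -> exists x, ~ form_zero (lincomb_form a b (w i) (w j)) x.
Proof.
move=> free ij a0; apply: contrapT => H.
pose c (k : 'I_g) : CC R := if k == i then a else if k == j then b else 0.
suff /free/(_ i) : is_lincomb_form w c (fun _ _ => 0).
  by rewrite /c eqxx => E; rewrite E eqxx in a0.
move=> phi aphi x xd.
have Z : form_zero (lincomb_form a b (w i) (w j)) x.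
  by apply: contrapT => nz; apply: H; exists x.
have ji : j != i by rewrite eq_sym.
rewrite (bigD1 i)//= (bigD1 j)//= big1 => [|k /andP[ki kj]].
  by rewrite addr0 /c eqxx (negbTE ji) eqxx -(Z phi aphi xd).
by rewrite /c (negbTE ki) (negbTE kj) scale0r.
Qed.

(** * Slices of a map on a product, and the dependence on one factor *)

Section Slices.
Context (R : realType) (n1 n2 n : nat).
Context (Y1 : complexManifold R n1) (Y2 : complexManifold R n2) (X : complexManifold R n).
Context (f : prod_manifold Y1 Y2 -> X).
Hypothesis fh : holomorphic f.

(** In a product chart the slice is f composed with [q], which freezes the second block of
    coordinates. *)
Lemma holomorphic_slice1 (y2 : Y2) : holomorphic (fun y1 : Y1 => f (y1, y2)).
Proof.
case: fh => fc fd; split=> [y1|phi psi aphi apsi y1 y1d d].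
  apply: (@continuous_comp _ _ _ (fun y1 : Y1 => (y1, y2)) f); last exact: fc.
  by apply: cvg_pair; [exact: cvg_id|exact: cvg_cst].
have [phi2 aphi2 y2d] := atlas_cover y2.
pose q (v : 'rV[CC R]_n1) : 'rV[CC R]_(n1 + n2) := row_mx v (phi2 y2).
have -> : psi \o (fun y1 : Y1 => f (y1, y2)) \o chart_inv phi =
    (psi \o f \o chart_inv (prod_chart phi phi2)) \o q.
  by apply/funext => v; rewrite /= row_mxKl row_mxKr chart_mapK.
apply: (@differentiable_comp _ _ _ _ q (psi \o f \o chart_inv (prod_chart phi phi2))).
  apply: differentiable_row_mx; last exact: differentiable_cst.
  exact: ex_diff.
apply: (fd (prod_chart phi phi2) psi _ apsi (y1, y2)) => //.
by exists phi => //; exists phi2.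
Qed.

Lemma holomorphic_slice2 (y1 : Y1) : holomorphic (fun y2 : Y2 => f (y1, y2)).
Proof.
case: fh => fc fd; split=> [y2|phi psi aphi apsi y2 y2d d].
  apply: (@continuous_comp _ _ _ (fun y2 : Y2 => (y1, y2)) f); last exact: fc.
  by apply: cvg_pair; [exact: cvg_cst|exact: cvg_id].
have [phi1 aphi1 y1d] := atlas_cover y1.
pose q (v : 'rV[CC R]_n2) : 'rV[CC R]_(n1 + n2) := row_mx (phi1 y1) v.
have -> : psi \o (fun y2 : Y2 => f (y1, y2)) \o chart_inv phi =
    (psi \o f \o chart_inv (prod_chart phi1 phi)) \o q.
  by apply/funext => v; rewrite /= row_mxKl row_mxKr chart_mapK.
apply: (@differentiable_comp _ _ _ _ q (psi \o f \o chart_inv (prod_chart phi1 phi))).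
  apply: differentiable_row_mx; first exact: differentiable_cst.
  exact: ex_diff.
apply: (fd (prod_chart phi1 phi) psi _ apsi (y1, y2)) => //.
by exists phi1 => //; exists phi.
Qed.

End Slices.

Theorem proposition1p4 (R : realType) (n1 n2 : nat)
    (Y1 : complexManifold R n1) (Y2 : complexManifold R n2)
    (Y1_compact : compact [set: Y1]) (Y1_connected : connected [set: Y1])
    (Y2_compact : compact [set: Y2]) (Y2_connected : connected [set: Y2])
    (X : complexManifold R 1)
    (X_compact : compact [set: X]) (X_connected : connected [set: X])
    (g : nat) (X_genus : has_genus X g) (g_ge2 : (2 <= g)%N)
    (f : prod_manifold Y1 Y2 -> X) (f_holomorphic : holomorphic f) :
  (forall (y1 y1' : Y1) (y2 : Y2), f (y1, y2) = f (y1', y2)) \/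
  (forall (y1 : Y1) (y2 y2' : Y2), f (y1, y2) = f (y1, y2')).
Proof.
pose F (y1 : Y1) (y2 : Y2) : X := f (y1, y2).
have F1 y2 : holomorphic (F ^~ y2) by exact: holomorphic_slice1.
have F2 y1 : holomorphic (F y1) by exact: holomorphic_slice2.
have Fc : continuous (fun p : Y1 * Y2 => F p.1 p.2).
  have -> : (fun p : Y1 * Y2 => F p.1 p.2) = f by apply/funext => -[].
  exact: (proj1 f_holomorphic).
have Fc' : continuous (fun p : Y2 * Y1 => F p.2 p.1).
  move=> [y2 y1]; apply: (@continuous_comp _ _ _ (fun p : Y2 * Y1 => (p.2, p.1))
    (fun p : Y1 * Y2 => F p.1 p.2)); last exact: Fc.
  by apply: cvg_pair; [exact: cvg_snd|exact: cvg_fst].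
have [w [w_free _]] := X_genus.
pose i0 : 'I_g := Ordinal (ltnW g_ge2); pose i1 : 'I_g := Ordinal g_ge2.
have isolated (i j : 'I_g) (a b : CC R) : i != j -> a != 0 ->
    isolated_form_zeros (lincomb_form a b (w i) (w j)).
  by move=> ij a0; apply: nonzero_form_isolated_zeros => //; exact: lincomb_form_neq0.
have w0_isolated : isolated_form_zeros (w i0).
  apply: nonzero_form_isolated_zeros => //.
  (* [w i0] is treated as the combination with coefficients 1 and 0. *)
  have [//||x nz] := @lincomb_form_neq0 _ _ _ w i0 i1 1 0 w_free; first exact: oner_neq0.
  exists x => z; apply: nz => psi apsi xd /=.
  by rewrite (z psi apsi xd) scaler0 scale0r addr0.
have [H|] := pselect (forall (phi : chart R n1 Y1) a v y, atlas phi -> chart_dom phi a ->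
    form_on (w i0) (fun s => F (line phi a v s) y) = 0).
  left=> y1 y1' y2; apply: (pullback_zero_const Y1_connected (F1 y2) w0_isolated).
  by move=> phi a v aphi ad; exact: (H phi a v y2).
move=> /existsNP[phi /existsNP[a /existsNP[v /existsNP[y]]]].
move=> /not_implyP[aphi /not_implyP[ad /eqP al0]]; right.
pose q y s := F (line phi a v s) y.
have const w' y' : form_on w' (q y') = form_on w' (q y).
  exact: (pullback_constant Fc F1 F2 w' aphi ad v Y2_compact Y2_connected).
have Fa_const : forall y y', F a y = F a y'.
  apply: (image_in_zeros_const Y2_connected (proj1 (F2 a))
    (isolated i1 i0 _ (- form_on (w i1) (q y)) isT al0)).
  move=> y'; set x := F a y'.
  have xd := chart_at_dom x; have apsi := chart_at_atlas x.
  have curve : holomorphic_curve (q y') by exact: (line_holomorphic_curve (F1 y') aphi v ad).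
  have q0 : q y' 0 = x by rewrite /q line0.
  apply: (form_zeroP apsi xd).
  (* At [y'] both constants are the derivative of the same curve times the coefficient of the
     respective form at [x]; hence the combination vanishes at [x] by commutativity. *)
  rewrite -(const (w i0) y') -(const (w i1) y').
  rewrite (form_onE (w i0) curve apsi) ?q0// (form_onE (w i1) curve apsi) ?q0//.
  by rewrite !mxE; ring.
suff H y1 : forall y2 y2', F y1 y2 = F y1 y2' by move=> y1; exact: H.
apply: (pullback_zero_const Y2_connected (F2 y1) w0_isolated) => phi2 b u aphi2 bd.
(* The factors exchange roles: the value at [y1] on a direction of Y2 equals the value at [a], where
   the curve is constant. *)
rewrite [LHS](@pullback_constant R X n2 n1 Y2 Y1 (fun y2 y1 => F y1 y2) Fc' F2 F1
  (w i0) phi2 aphi2 b bd u Y1_compact Y1_connected y1 a).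
have E : (fun s => F a (line phi2 b u s)) = (fun=> F a b) by apply/funext => s.
rewrite E; set psi := chart_at (F a b).
rewrite /form_on -/psi.
have D : is_derive (0 : CC R) (1 : CC R) (fun=> psi (F a b)) 0 by exact: is_derive_cst.
by rewrite (_ : psi \o _ = fun=> psi (F a b))// derive_val mul0mx mxE.
Qed.
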